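(* For all integers $d \geq k > k' \geq 0$ there is a constant $c > 0$, depending only on $d$, $k$ and $k'$, such that the following holds. Let $F$ be a finite field, let $n$ be a positive integer, let $0 \leq \beta \leq k'+1$, and let $\mathbf{L}$ be a collection (set) of $k$-planes in $F^n$ with $$|\mathbf{L}| \geq |F|^{(k+1)(d-k)+\beta}.$$ For $L \in \mathbf{L}$ let $\mathbf{P}_L$ be the set of all $k'$-planes $P$ with $P \subset L$. Then $$\Big|\bigcup_{L \in \mathbf{L}} \mathbf{P}_L\Big| \geq c\,|F|^{(k'+1)(d-k')+\beta}.$$
   Context: $|\cdot|$ denotes cardinality. A $k$-plane in $F^n$ is a translate of a $k$-dimensional linear subspace of $F^n$; a $0$-plane is a point. The union $\bigcup_{L}\mathbf{P}_L$ is a set of $k'$-planes, and its cardinality is the number of distinct $k'$-planes in it. *)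

(* Defs.v *)
From HB Require Import structures.
From mathcomp Require Import all_boot all_order all_algebra.
From mathcomp Require Import boolp reals exp.

Set Implicit Arguments.
Unset Strict Implicit.
Unset Printing Implicit Defensive.

Import Order.TTheory GRing.Theory Num.Theory.

Local Open Scope ring_scope.

Definition is_plane (F : finFieldType) (n k : nat) (P : {set 'rV[F]_n}) : Prop :=
  exists (v : 'rV[F]_n) (V : {vspace 'rV[F]_n}),
    \dim V = k /\ P = [set v + w | w in V].

Definition planes_in (F : finFieldType) (n k' : nat) (L : {set 'rV[F]_n}) :
    {set {set 'rV[F]_n}} :=
  [set P : {set 'rV[F]_n} | `[< is_plane k' P >] & P \subset L].

(* Main.v *)
Require Import Defs.
From HB Require Import structures.
From mathcomp Require Import all_boot all_order all_algebra.
From mathcomp Require Import boolp reals exp.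
From mathcomp Require Import finfield zify ring lra.

Set Implicit Arguments.
Unset Strict Implicit.
Unset Printing Implicit Defensive.

Import Order.TTheory GRing.Theory Num.Theory.

Local Open Scope ring_scope.

(** Write q for the cardinality of the field.  The exponent beta disappears if the
claim is put as a ratio: [shadow_bound d k k'] bounds the shadow from below by
a constant times q^((k'+1)(d-k') - (k+1)(d-k)) per plane of the family, as long
as at most q^((k+1)(d-k)+k'+1) planes are counted.  In this form the bounds for
k -> k-1 -> ... -> k' compose ([shadow_bound_all]), so the shadow is taken one
dimension at a time.

Lines and points ([lines_union]).  Let N <= q^(2d-1) lines lie densely in a
point set X with N q^2 much larger than |X| q^d.  A family B_j of j-planes dense
in X is built for j = 1, ..., d, starting from the lines.  Two members of B_j
sharing a member of B_(j-1) form a hinge and span a (j+1)-plane.  A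
(j+1)-plane with at least q members of B_j is again dense in X, because planes
of the same dimension overlap very little ([almost_disjoint_union]).  If most
hinges of some plane L spanned (j+1)-planes with fewer than q members of B_j,
their free sides would be almost disjoint away from L and would fill more
points than X has; this is the hairbrush argument of Wolff
([poor_hinges_leq]).  So most hinges lie in rich (j+1)-planes, which form
B_(j+1).  The number D of hinges per member of B_j hardly changes with j: a
plane of B_(j+1) with v members of B_j contributes v^2 hinges, and v is at most
about q^(j+1), whence |B_(j+1)| is at least about D |B_j| / q^(2j+2)
([chain_step]).  For j = d this gives about N / q^(2d-2) planes of dimension d
dense in X, and their union has the required size.

The multiplicities v are not constant, and losing a logarithm of q is not
affordable.  The dyadic class of planes with v about V / 2^i is therefore chosen
with a weight t^i, for a fixed t slightly below 1 ([dyadic_pigeonhole]).  Such a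
class loses a factor t^i in the number of hinges but gains (4t)^i in the number
of planes, and this gain pays for the losses in all later steps.

Planes of higher dimension ([shadow_bound_succ]).  The planes of the family
through a point p, cut by a hyperplane that avoids p, form a family of dimension
one less ([link_at_point]); the induction hypothesis for these families, summed
over p, is exactly the claim, unless most incidences are at points lying on too
many planes.  Let Y be the set of these heavy points.  It is small, by counting
incidences, and it is dense in a quarter of the planes.  But a k-plane is
spanned by a line and k-1 further points, so that many planes in which Y is
dense need many lines in which Y is dense, and by [lines_union] these need many
points of Y ([heavy_points]). *)

(** * Affine planes over a finite field *)

Local Open Scope nat_scope.

Section Planes.
Variables (F : finFieldType) (n : nat).
Implicit Types (P Q R L M H X Y : {set 'rV[F]_n}) (x y p : 'rV[F]_n) (k m j : nat).
Local Notation q := #|F|.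

Lemma field_card_gt1 : 1 < q. Proof. exact: card_finRing_gt1. Qed.

Lemma field_card_gt0 : 0 < q. Proof. exact: ltn_trans field_card_gt1. Qed.

(** Any point of a plane serves as its origin; membership then becomes linear,
which is how all later facts about planes are checked. *)
Lemma plane_at k P x :
  is_plane k P -> x \in P ->
  exists2 V : {vspace 'rV[F]_n}, \dim V = k & forall y, (y \in P) = (y - x \in V)%R.
Proof.
move=> [v [V [dV ->]]] /imsetP [w wV ->]; exists V => // y.
apply/imsetP/idP => [[u uV ->]|yV].
  by rewrite opprD addrACA subrr add0r rpredB.
exists (y - v)%R; last by rewrite addrC subrK.
by rewrite -(subrK w (y - v)%R) -[(y - v - w)%R]addrA -opprD rpredD.
Qed.

Lemma plane_of k x (V : {vspace 'rV[F]_n}) P :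
  \dim V = k -> (forall y, (y \in P) = (y - x \in V)%R) -> is_plane k P.
Proof.
move=> dV hP; exists x, V; split => //; apply/setP => y; rewrite hP.
apply/idP/imsetP => [yV|[w wV ->]]; first by exists (y - x)%R; rewrite // addrC subrK.
by rewrite addrC addKr.
Qed.

Lemma plane_card k P : is_plane k P -> #|P| = q ^ k.
Proof.
move=> [v [V [<- ->]]]; rewrite card_imset; first by rewrite card_vspace.
by move=> a b /addrI.
Qed.

Lemma plane_inh k P : is_plane k P -> exists x, x \in P.
Proof.
move=> /plane_card h; by apply/set0Pn; rewrite -card_gt0 h expn_gt0 field_card_gt0.
Qed.

Lemma plane_set1 x : is_plane 0 [set x].
Proof.
apply: (@plane_of 0 x 0%VS) => [|y]; first exact: dimv0.
by rewrite inE memv0 subr_eq0.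
Qed.

Lemma plane_sub_eq k m P Q :
  is_plane k P -> is_plane m Q -> P \subset Q -> m <= k -> P = Q.
Proof.
move=> hP hQ sPQ mk; apply/eqP; rewrite eqEcard sPQ (plane_card hP) (plane_card hQ).
by rewrite leq_exp2l // field_card_gt1.
Qed.

Lemma plane_cap k m P Q x :
  is_plane k P -> is_plane m Q -> x \in P -> x \in Q -> exists r, is_plane r (P :&: Q).
Proof.
move=> hP hQ xP xQ; have [V _ hV] := plane_at hP xP; have [W _ hW] := plane_at hQ xQ.
exists (\dim (V :&: W)%VS); apply: (@plane_of _ x (V :&: W)%VS) => // y.
by rewrite inE hV hW memv_cap.
Qed.

Lemma plane_capI k P Q : is_plane k.+1 P -> is_plane k.+1 Q -> P != Q ->
  #|P :&: Q| <= q ^ k.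
Proof.
move=> hP hQ neq; have [->|[x]] := set_0Vmem (P :&: Q); first by rewrite cards0.
rewrite inE => /andP [xP xQ]; have [r hr] := plane_cap hP hQ xP xQ.
rewrite (plane_card hr) leq_exp2l ?field_card_gt1 // -ltnS ltnNge; apply/negP => kr.
have e1 := plane_sub_eq hr hP (subsetIl _ _) kr.
have e2 := plane_sub_eq hr hQ (subsetIr _ _) kr.
by move: neq; rewrite -{1}e1 -{2}e2 eqxx.
Qed.

(** The span of a plane and an outside point, given by its minimality among
planes; everything that follows about spans uses only this. *)
Lemma plane_join k P x : is_plane k P -> x \notin P ->
  exists R, [/\ is_plane k.+1 R, P \subset R, x \in R &
    forall m Q, is_plane m Q -> P \subset Q -> x \in Q -> R \subset Q].
Proof.
move=> hP xP; have [o oP] := plane_inh hP; have [V dV hV] := plane_at hP oP.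
pose R : {set 'rV[F]_n} := [set y | (y - o)%R \in (V + <[x - o]>)%VS].
have hR y : (y \in R) = ((y - o)%R \in (V + <[x - o]>)%VS) by rewrite inE.
exists R; split.
- apply: (@plane_of _ o (V + <[x - o]>)%VS) => //.
  rewrite dimv_disjoint_sum; first by
    rewrite dV dim_vline subr_eq0; case: eqP xP => [->|]; rewrite ?oP ?addn1.
  apply/eqP; rewrite -subv0; apply/subvP => z; rewrite memv_cap => /andP [zV /vlineP [c zc]].
  rewrite memv0 zc; move: zV; rewrite zc; case: (eqVneq c 0%R) => [->|c0]; first by rewrite scale0r.
  move=> /(memvZ c^-1%R); rewrite scalerA mulVf // scale1r -hV => h.
  by rewrite h in xP.
- apply/subsetP => y; rewrite hR hV => h; exact: (subvP (addvSl _ _)).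
- by rewrite hR; apply: (subvP (addvSr _ _)); exact: memv_line.
- move=> m Q hQ sPQ xQ; have [W _ hW] := plane_at hQ (subsetP sPQ _ oP).
  apply/subsetP => y; rewrite hR hW; apply/subvP.
  rewrite subv_add -memvE -hW xQ andbT; apply/subvP => z zV.
  have : (z + o)%R \in P by rewrite hV addrK.
  by move/(subsetP sPQ); rewrite hW addrK.
Qed.

End Planes.

(** * Double counting *)

Local Open Scope nat_scope.

Lemma sum_sqr_leq (I : finType) (A : {set I}) (f : I -> nat) :
  (\sum_(i in A) f i) ^ 2 <= #|A| * \sum_(i in A) f i ^ 2.
Proof.
rewrite -(leq_pmul2l (isT : 0 < 2)) -mulnn big_distrlr /=.
rewrite big_distrr /=.
have -> : 2 * (#|A| * \sum_(i in A) f i ^ 2) =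
    \sum_(i in A) \sum_(j in A) (f i ^ 2 + f j ^ 2).
  transitivity (\sum_(i in A) (#|A| * f i ^ 2 + \sum_(j in A) f j ^ 2)).
    by rewrite big_split /= sum_nat_const -big_distrr /= mul2n addnn.
  by apply: eq_bigr => i _; rewrite big_split /= sum_nat_const.
by apply: leq_sum => i _; rewrite big_distrr; apply: leq_sum => j _; exact: nat_Cauchy.
Qed.

Lemma card_sum_mem (T : finType) (U A : {set T}) : A \subset U -> #|A| = \sum_(x in U) (x \in A).
Proof.
move=> sAU; rewrite -sum1_card big_mkcond [RHS]big_mkcond; apply: eq_bigr => x _.
by case: (boolP (x \in A)) => [/(subsetP sAU) ->|]; case: (x \in U).
Qed.

Lemma sum_mem_card (I : finType) (A : {set I}) (p : pred I) :
  \sum_(i in A) p i = #|[set i in A | p i]|.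
Proof.
rewrite -sum1_card big_mkcond [RHS]big_mkcond; apply: eq_bigr => i _.
by rewrite inE; case: (i \in A) => //; case: (p i).
Qed.

(** Cauchy-Schwarz for the number of sets [S b] through a point: the second
moment of this number is governed by the pairwise intersections, so if these are
no larger than the sets themselves on average, the union is about as large as
for disjoint sets. *)
Lemma almost_disjoint_union (I T : finType) (H : {set I}) (S : I -> {set T}) (U : {set T}) a w :
  (forall b, b \in H -> S b \subset U) ->
  (forall b, b \in H -> w <= a * #|S b|) ->
  (forall b, b \in H -> \sum_(c in H | c != b) #|S b :&: S c| <= w) ->
  #|H| * w <= (a + a * a) * #|U|.
Proof.
move=> hU hS hI.
pose N := \sum_(b in H) #|S b|.
have wN : #|H| * w <= a * N.
  by rewrite -sum_nat_const big_distrr; apply: leq_sum => b /hS.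
have N2 : N ^ 2 <= #|U| * (N + #|H| * w).
  have {1}-> : N = \sum_(x in U) \sum_(b in H) (x \in S b).
    by rewrite exchange_big; apply: eq_bigr => b /hU /card_sum_mem.
  apply: leq_trans (sum_sqr_leq _ _) _; rewrite leq_mul2l; apply/orP; right.
  have -> : \sum_(x in U) (\sum_(b in H) (x \in S b)) ^ 2 =
      \sum_(b in H) \sum_(c in H) #|S b :&: S c|.
    under eq_bigr do rewrite -mulnn big_distrlr /=.
    rewrite exchange_big; apply: eq_bigr => b bH; rewrite exchange_big.
    apply: eq_bigr => c cH; rewrite (@card_sum_mem _ U); last by rewrite subIset // hU.
    by apply: eq_bigr => x _; rewrite inE mulnb.
  rewrite -sum_nat_const -big_split /=; apply: leq_sum => b bH.
  rewrite (bigD1 b) //= setIid leq_add2l; exact: hI.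
have [N0|Npos] := posnP N; first by move: wN; rewrite N0 muln0 leqn0 => /eqP ->.
have : N <= #|U| * (1 + a).
  rewrite -(leq_pmul2r Npos) mulnn; apply: leq_trans N2 _.
  by rewrite -mulnA leq_mul2l mulnDl mul1n leq_add2l wN orbT.
move=> h; apply: leq_trans wN _; apply: leq_trans (leq_mul (leqnn a) h) _; nia.
Qed.


Section Span.
Variables (F : finFieldType) (n : nat).
Implicit Types (P Q R L M X Y : {set 'rV[F]_n}) (x y p : 'rV[F]_n) (k m j : nat).
Local Notation q := #|F|.

(** Two planes that share a hyperplane of both span only one dimension more. *)
Lemma hinge_span j Q L L' :
  is_plane j Q -> is_plane j.+1 L -> is_plane j.+1 L' -> L != L' ->
  Q \subset L -> Q \subset L' ->
  exists R, [/\ is_plane j.+2 R, L \subset R & L' \subset R].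
Proof.
move=> hQ hL hL' neq sQL sQL'.
have /subsetPn [x xL' xL] : ~~ (L' \subset L).
  by apply: contraNN neq => s; rewrite (plane_sub_eq hL' hL s).
have [R [hR sLR xR _]] := plane_join hL xL.
exists R; split => //.
have xQ : x \notin Q by apply: contraNN xL; exact: (subsetP sQL).
have [P [hP _ _ minP]] := plane_join hQ xQ.
have ePL' := plane_sub_eq hP hL' (minP _ _ hL' sQL' xL') (leqnn _).
by rewrite -ePL'; apply: minP hR _ xR; exact: subset_trans sQL sLR.
Qed.

(** A plane of dimension [m + r] through [M] is spanned by [M] and [r] successive
points of [Y], and at each stage at least [z] of its points lie outside the
span reached so far.  Counting such sequences of points by peeling off the first
one gives the bound. *)
Lemma count_planes_through r m M (LL : {set {set 'rV[F]_n}}) Y z :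
  is_plane m M ->
  (forall L, L \in LL -> [/\ is_plane (m + r) L, M \subset L &
     0 < r -> q ^ (m + r).-1 + z <= #|Y :&: L|]) ->
  #|LL| * z ^ r <= #|Y| ^ r.
Proof.
elim: r m M LL => [|r IH] m M LL hM hLL.
  rewrite !expn0 muln1; apply: (@leq_trans #|[set M]|); last by rewrite cards1.
  apply/subset_leq_card/subsetP => L /hLL [].
  by rewrite addn0 inE => hL sML _; rewrite (plane_sub_eq hM hL).
rewrite !expnS mulnA.
have step : #|LL| * z <= \sum_(y in Y :\: M) #|[set L in LL | y \in L]|.
  under eq_bigr do rewrite -sum_mem_card.
  rewrite exchange_big -sum_nat_const; apply: leq_sum => L /hLL [_ sML /(_ isT)].
  have -> : (\sum_(y in Y :\: M) (y \in L) = #|(Y :&: L) :\: M|).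
    rewrite sum_mem_card; apply: eq_card => y; rewrite !inE.
    by rewrite -andbA.
  rewrite cardsD addnS /= => h.
  have : #|Y :&: L :&: M| <= q ^ (m + r).
    apply: leq_trans (subset_leq_card (subsetIr _ _)) _.
    by rewrite (plane_card hM) leq_exp2l ?field_card_gt1 // leq_addr.
  by move=> h2; apply: leq_trans (leq_sub h h2); rewrite addKn.
apply: leq_trans (leq_mul step (leqnn _)) _; rewrite big_distrl /=.
(* Planes through [M] and [y] are planes through their span, one dimension up. *)
have h1 : \sum_(y in Y :\: M) #|[set L in LL | y \in L]| * z ^ r <= #|Y :\: M| * #|Y| ^ r.
  rewrite -sum_nat_const; apply: leq_sum => y; rewrite inE => /andP [yM yY].
  have [P [hP sMP yP minP]] := plane_join hM yM.
  apply: (IH m.+1 P) => // L; rewrite inE => /andP [/hLL [hL sML h] yL].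
  rewrite addSnnS; split => //; first exact: minP hL sML yL.
  by move=> _; exact: h.
apply: leq_trans h1 _; rewrite leq_mul2r subset_leq_card ?orbT //.
exact: subsetDl.
Qed.

(** Flags of points: the case [m = 0] of [count_planes_through] at every point of
[R]. *)
Lemma count_subplanes j R (LL : {set {set 'rV[F]_n}}) :
  is_plane j.+1 R -> (forall L, L \in LL -> is_plane j L /\ L \subset R) ->
  #|LL| <= 2 ^ j * q ^ j.+1.
Proof.
move=> hR hLL.
have q0 := field_card_gt0; have q1 := field_card_gt1 F.
pose z := q ^ j - q ^ j.-1.
have zq : q ^ (j * j) <= 2 ^ j * z ^ j.
  rewrite /z expnM -expnMn; case: j {hR hLL z} => [|j] //; rewrite leq_exp2r //=.
  have : 2 * q ^ j <= q ^ j.+1 by rewrite expnS leq_mul2r q1 orbT.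
  by move=> h; rewrite mulnBr (mul2n (q ^ j.+1)) -addnn -addnBA // leq_addr.
have cLL : #|LL| * q ^ j <= \sum_(p in R) #|[set L in LL | p \in L]|.
  under eq_bigr do rewrite -sum_mem_card.
  rewrite exchange_big -sum_nat_const; apply: leq_sum => L /hLL [hL sLR].
  by rewrite -(card_sum_mem sLR) (plane_card hL).
have cR : \sum_(p in R) #|[set L in LL | p \in L]| * z ^ j <= #|R| * #|R| ^ j.
  rewrite -sum_nat_const; apply: leq_sum => p pR.
  apply: (@count_planes_through j 0 [set p]); first exact: plane_set1.
  move=> L; rewrite inE add0n => /andP [/hLL [hL sLR] pL].
  rewrite sub1set; split => // j0; rewrite (setIidPr sLR) (plane_card hL) /z.
  by rewrite subnKC // leq_exp2l // leq_pred.
rewrite (plane_card hR) -expnS -expnM in cR.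
have e : q ^ j.+1 * q ^ (j + j * j) = q ^ (j.+1 * j.+1) by rewrite -expnD; congr (_ ^ _); lia.
have pos : 0 < q ^ (j + j * j) by rewrite expn_gt0 q0.
rewrite -(leq_pmul2r pos) -mulnA e expnD mulnA.
apply: leq_trans (leq_mul cLL zq) _.
by rewrite mulnCA leq_mul2l big_distrl /= cR orbT.
Qed.

End Span.

(** * Hinges: pairs of planes sharing a hyperplane *)

Local Open Scope nat_scope.

Lemma exists_subset_card (T : finType) (A : {set T}) k :
  k <= #|A| -> exists2 B : {set T}, B \subset A & #|B| = k.
Proof.
move=> kA; exists [set x in take k (enum A)].
  by apply/subsetP => x; rewrite inE => /mem_take; rewrite mem_enum.
rewrite cardsE (card_uniqP _) ?take_uniq ?enum_uniq // size_take -cardE.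
by case: ltngtP kA.
Qed.

Section Hinge.
Variables (F : finFieldType) (n : nat).
Implicit Types (P Q R L M X Y U : {set 'rV[F]_n}) (x y p : 'rV[F]_n) (k m j : nat).
Implicit Types (A B LL : {set {set 'rV[F]_n}}).
Local Notation q := #|F|.

Definition subplanes_of B R := [set L in B | L \subset R].

Definition dense_planes j a X B :=
  forall L, L \in B -> is_plane j L /\ q ^ j <= a * #|X :&: L|.

(** Restricting to at most [q] planes makes the total of the pairwise intersections
comparable with a single plane (the classical bound of Cordoba). *)
Lemma union_dense_planes j a X U LL :
  dense_planes j.+1 a X LL -> (forall L, L \in LL -> X :&: L \subset U) ->
  minn #|LL| q * q ^ j.+1 <= (a + a * a) * #|U|.
Proof.
move=> hLL sU; have [B sB cB] := exists_subset_card (geq_minl #|LL| q).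
rewrite -cB; apply: (almost_disjoint_union (S := fun L => X :&: L)).
- by move=> L /(subsetP sB) /sU.
- by move=> L /(subsetP sB) /hLL [].
move=> L LB; have [hL _] := hLL _ (subsetP sB _ LB).
apply: (@leq_trans (\sum_(c in B | c != L) q ^ j)).
  apply: leq_sum => M /andP [MB neq]; have [hM _] := hLL _ (subsetP sB _ MB).
  rewrite eq_sym in neq; apply: leq_trans (plane_capI hL hM neq).
  by apply: subset_leq_card; rewrite setISS // subsetIr.
rewrite sum_nat_const expnS leq_mul2r; apply/orP; right.
apply: leq_trans (_ : #|B| <= q); last by rewrite cB geq_minr.
by apply/subset_leq_card/subsetP => M; rewrite unfold_in => /andP [].
Qed.

(** It takes about [q] planes of dimension one less to fill a fixed proportion of a
[j]-plane. *)
Definition rich j B : {set {set 'rV[F]_n}} :=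
  [set R | `[< is_plane j R >] & q <= #|subplanes_of B R|].

Lemma rich_dense j a X B :
  dense_planes j.+1 a X B -> dense_planes j.+2 (a + a * a) X (rich j.+2 B).
Proof.
move=> hB R; rewrite inE => /andP [/asboolP hR hq]; split => //.
have h1 : dense_planes j.+1 a X (subplanes_of B R).
  by move=> L; rewrite inE => /andP [/hB].
have /(union_dense_planes h1) :
   forall L, L \in subplanes_of B R -> X :&: L \subset X :&: R.
  by move=> L; rewrite inE => /andP [_ sLR]; rewrite setIS.
by rewrite (minn_idPr hq) -expnS.
Qed.

(** [L] and [M] form a hinge along a member of [A], but their span is not rich. *)
Definition poor_hinge j A B L M :=
  [&& M != L, [exists Q in A, (Q \subset L) && (Q \subset M)] &
    ~~ [exists R in rich j B, (L \subset R) && (M \subset R)]].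

(** The hairbrush argument.  The planes spanned by [L] and the hairs [M] meet each
other only inside [L], so away from [L] a hair meets only hairs in its own span,
of which there are fewer than [q] because the span is not rich.  The hairs are
thus almost disjoint subsets of [X]. *)
Lemma poor_hinges_leq j a X A B L :
  (forall Q, Q \in A -> is_plane j Q) -> dense_planes j.+1 a X B ->
  2 * a <= q -> L \in B ->
  #|[set M in B | poor_hinge j.+2 A B L M]| * q ^ j.+1 <=
    (2 * a + 2 * a * (2 * a)) * #|X|.
Proof.
move=> hA hB aq LB; have [hL _] := hB _ LB.
set HH := [set M in B | _].
have hHH M : M \in HH -> [/\ is_plane j.+1 M, q ^ j.+1 <= a * #|X :&: M|, M != L,
    exists2 Q, is_plane j Q & (Q \subset L) && (Q \subset M) &
    forall R, R \in rich j.+2 B -> L \subset R -> M \subset R -> false].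
  rewrite inE => /andP [/hB [hM dM] /and3P [neq /exists_inP [Q QA sQ] hR]].
  split => //; first by exists Q => //; exact: hA.
  move=> R Rr sL sM; apply: contraR hR => _.
  by apply/exists_inP; exists R; rewrite ?sL.
apply: (almost_disjoint_union (S := fun M => (X :&: M) :\: L)).
- by move=> M _; rewrite subDset subsetU // subsetIl orbT.
- move=> M /hHH [hM dM neq _ _]; rewrite eq_sym in neq.
  have h := plane_capI hL hM neq.
  have h2 : #|X :&: M :&: L| <= q ^ j.
    by apply: leq_trans h; rewrite subset_leq_card // setIAC setISS ?subsetIr.
  have h3 : 2 * a * #|X :&: M :&: L| <= q ^ j.+1 by rewrite expnS leq_mul.
  rewrite cardsD mulnBr -mulnA -(leq_add2r (2 * a * #|X :&: M :&: L|)).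
  rewrite mulnA subnK; last by rewrite leq_mul2l subset_leq_card ?orbT ?subsetIl.
  apply: leq_trans (leq_add (leqnn _) h3) _; rewrite addnn -mul2n -mulnA.
  by rewrite leq_mul2l dM orbT.
move=> M MH; have [hM dM neq [Q hQ /andP [sQL sQM]] nR] := hHH _ MH.
have neq' : L != M by rewrite eq_sym.
have [R [hR sLR sMR]] := hinge_span hQ hL hM neq' sQL sQM.
(* Hairs meeting the hair [M] off [L] lie in the span [R] of [L] and [M]. *)
have off N : N \in HH -> N != M ->
    (#|((X :&: M) :\: L) :&: ((X :&: N) :\: L)| <= (N \subset R) * q ^ j).
  move=> NH nNM; have [hN dN neqN [Q' hQ' /andP [sQ'L sQ'N]] _] := hHH _ NH.
  have [->|[y]] := set_0Vmem (((X :&: M) :\: L) :&: ((X :&: N) :\: L)); first by rewrite cards0.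
  rewrite !inE => /andP [/andP [yL /andP [yX yM]] /andP [_ /andP [_ yN]]].
  have [R' [hR' sLR' yR' minR']] := plane_join hL yL.
  have neqN' : L != N by rewrite eq_sym.
  have [R2 [hR2 sLR2 sNR2]] := hinge_span hQ' hL hN neqN' sQ'L sQ'N.
  have e1 := plane_sub_eq hR' hR (minR' _ _ hR sLR (subsetP sMR _ yM)) (leqnn _).
  have e2 := plane_sub_eq hR' hR2 (minR' _ _ hR2 sLR2 (subsetP sNR2 _ yN)) (leqnn _).
  rewrite -e1 e2 sNR2 mul1n; rewrite eq_sym in nNM.
  apply: leq_trans (plane_capI hM hN nNM); apply: subset_leq_card.
  by apply: setISS; rewrite subDset subsetU // subsetIr orbT.
apply: (@leq_trans (\sum_(c in HH | c != M) (c \subset R) * q ^ j)).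
  by apply: leq_sum => N /andP [NH nNM]; exact: off.
rewrite -big_distrl expnS leq_mul2r; apply/orP; right.
apply: (@leq_trans #|subplanes_of B R|).
  apply: (@leq_trans (\sum_(c in HH) (c \subset R))).
    by rewrite big_mkcondr; apply: leq_sum => N _; case: ifP.
  rewrite sum_mem_card; apply/subset_leq_card/subsetP => N.
  by rewrite !inE => /andP [/andP [-> _] ->].
rewrite leqNgt; apply/negP => lt.
apply/notF/(nR R) => //; rewrite inE (ltnW lt) andbT; exact/asboolP.
Qed.

(** The left-hand side counts triples of a member of [A] and two members of [B]
containing it.  Two distinct members of [B] share at most one member of [A],
and then either lie together in a rich plane or form a poor hinge. *)
Lemma hinge_count j a X A B :
  (forall Q, Q \in A -> is_plane j Q) -> dense_planes j.+1 a X B ->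
  2 * a <= q ->
  q ^ j.+1 * (\sum_(Q in A) #|[set L in B | Q \subset L]| ^ 2) <=
  q ^ j.+1 * (\sum_(R in rich j.+2 B) #|subplanes_of B R| ^ 2 +
     \sum_(Q in A) #|[set L in B | Q \subset L]|) +
  #|B| * ((2 * a + 2 * a * (2 * a)) * #|X|).
Proof.
move=> hA hB aq.
have sqE (D : {set {set 'rV[F]_n}}) (r : {set 'rV[F]_n} -> {set 'rV[F]_n} -> bool) :
    \sum_(Q in D) #|[set L in B | r Q L]| ^ 2 =
    \sum_(L in B) \sum_(M in B) \sum_(Q in D) (r Q L && r Q M).
  under eq_bigr do rewrite -sum_mem_card -mulnn big_distrlr /=.
  rewrite exchange_big; apply: eq_bigr => L _; rewrite exchange_big.
  by apply: eq_bigr => M _; apply: eq_bigr => Q _; rewrite mulnb.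
have E : \sum_(Q in A) #|[set L in B | Q \subset L]| =
    \sum_(L in B) \sum_(M in B) (M == L) * \sum_(Q in A) (Q \subset L).
  under eq_bigr do rewrite -sum_mem_card.
  rewrite exchange_big; apply: eq_bigr => L LB.
  rewrite [RHS](bigD1 L) //= eqxx mul1n [X in _ + X]big1 ?addn0 // => M /andP [_ /negPf ->].
  by rewrite mul0n.
have pt L M : L \in B -> M \in B ->
  \sum_(Q in A) ((Q \subset L) && (Q \subset M)) <=
  \sum_(R in rich j.+2 B) ((L \subset R) && (M \subset R)) +
  (M == L) * \sum_(Q in A) (Q \subset L) + poor_hinge j.+2 A B L M.
  move=> LB MB; case: (eqVneq M L) => [->|neq].
    rewrite mul1n -addnA addnCA; apply: leq_trans (leq_addr _ _).
    by apply: leq_sum => Q _; rewrite andbb.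
  rewrite mul0n addn0 /poor_hinge neq /=.
  have [hL _] := hB _ LB; have [hM _] := hB _ MB.
  have neq' : L != M by rewrite eq_sym.
  have le1 : \sum_(Q in A) ((Q \subset L) && (Q \subset M)) <= 1.
    rewrite sum_mem_card; apply/card_le1_eqP => Q1 Q2.
    have h Q : Q \in [set i in A | (i \subset L) && (i \subset M)] -> Q = L :&: M.
      rewrite inE => /andP [QA s]; apply/eqP; rewrite eqEcard subsetI s /=.
      by rewrite (plane_card (hA _ QA)) plane_capI.
    by move=> /h -> /h ->.
  case: (boolP [exists Q in A, _]) => [_|nQ]; last first.
    rewrite big1 // => Q QA; move: nQ; rewrite negb_exists => /forallP /(_ Q).
    by rewrite QA /= => /negPf ->.
  apply: leq_trans le1 _; case: (boolP [exists R in _, _]) => [/exists_inP [R hR s]|_].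
    by rewrite (bigD1 R) //= s.
  by rewrite addn1.
rewrite (sqE A (fun Q L => Q \subset L)) (sqE (rich j.+2 B) (fun R L => L \subset R)) E.
rewrite -big_split /=.
under [X in _ <= _ * X + _]eq_bigr do rewrite -big_split /=.
apply: (@leq_trans (q ^ j.+1 * \sum_(L in B) (\sum_(M in B)
   (\sum_(R in rich j.+2 B) ((L \subset R) && (M \subset R)) +
  (M == L) * \sum_(Q in A) (Q \subset L)) + \sum_(M in B) poor_hinge j.+2 A B L M))).
  rewrite leq_mul2l; apply/orP; right; apply: leq_sum => L LB.
  by rewrite -big_split; apply: leq_sum => M MB; exact: pt.
rewrite big_split /= mulnDr leq_add2l mulnC big_distrl /= -sum_nat_const.
apply: leq_sum => L LB; rewrite sum_mem_card; exact: poor_hinges_leq.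
Qed.

End Hinge.

(** * Dyadic pigeonholing and estimates for the climb *)

Local Open Scope ring_scope.

(** The weights [(1 - t) * t ^+ i] sum to 1, so some dyadic class of values of [v]
carries at least its weighted share of the sum of squares.  A plain pigeonhole
over the classes would lose the number of classes, a logarithm of [V]. *)
Lemma dyadic_pigeonhole (I : finType) (S : {set I}) (v : I -> nat) (V : nat) (t : rat) :
  0 < t < 1 -> (forall R, R \in S -> (0 < v R <= V)%N) ->
  (0 < \sum_(R in S) v R ^ 2)%N ->
  exists i : nat,
    (1 - t) * t ^+ i * (\sum_(R in S) v R ^ 2)%N%:R * 4 ^+ i <=
    #|[set R in S | (2 ^ i * v R <= V < 2 ^ i.+1 * v R)%N]|%:R * V%:R ^+ 2.
Proof.
move=> /andP [t0 t1] hv T0; set T := (\sum_(R in S) _)%N in T0 *.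
have T0' : 0 < T%:R :> rat by rewrite ltr0n.
pose cl R := trunc_log 2 (V %/ v R).
have clP R : R \in S -> (2 ^ cl R * v R <= V < 2 ^ (cl R).+1 * v R)%N.
  move=> /hv /andP [v0 vV]; have d0 : (0 < V %/ v R)%N by rewrite divn_gt0.
  have /andP [h1 h2] := trunc_log_bounds (isT : (1 < 2)%N) d0.
  by rewrite -leq_divRL // -ltn_divLR // h1.
have clV R : (cl R < V.+1)%N.
  rewrite ltnS; apply: leq_trans (leq_div V (v R)).
  case: (posnP (V %/ v R)%N) => [h|h]; first by rewrite /cl h trunc_log0.
  have /andP [h1 _] := trunc_log_bounds (isT : (1 < 2)%N) h.
  by apply: leq_trans h1; apply: ltnW; exact: ltn_expl.
pose cls i := [set R in S | (2 ^ i * v R <= V < 2 ^ i.+1 * v R)%N].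
have [[i hi]|hn] := pselect (exists i : nat,
    (1 - t) * t ^+ i * T%:R * 4 ^+ i <= #|cls i|%:R * V%:R ^+ 2); first by exists i.
suff : T%:R <= (1 - t ^+ V.+1) * T%:R.
  by move=> h; have := mulr_gt0 (exprn_gt0 V.+1 t0) T0'; lra.
have {1}-> : T = (\sum_(i < V.+1) \sum_(R in S | inord (cl R) == i) v R ^ 2)%N.
  by rewrite -(partition_big (fun R => inord (cl R) : 'I_V.+1) predT).
have -> : (1 - t ^+ V.+1) * T%:R = \sum_(i < V.+1) (1 - t) * t ^+ i * T%:R.
  rewrite -mulr_suml -mulr_sumr; congr (_ * _).
  by have := subrX1 t V.+1; lra.
rewrite natr_sum; apply: ler_sum => i _.
have p4 : 0 < 4 ^+ i :> rat by rewrite exprn_gt0.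
rewrite -(ler_pM2r p4); apply: le_trans (_ : #|cls i|%:R * V%:R ^+ 2 <= _); last first.
  by rewrite leNgt; apply/negP => h; apply: hn; exists i; exact: ltW.
rewrite -!natrX -!natrM ler_nat big_distrl -sum_nat_const.
apply: (@leq_trans (\sum_(R in S | inord (cl R) == i) V ^ 2)%N).
  apply: leq_sum => R /andP [RS /eqP ci].
  have /andP [h _] := clP R RS.
  have ei : cl R = i by rewrite -ci inordK.
  rewrite /=; have -> : (v R ^ 2 * 4 ^ i = (2 ^ i * v R) ^ 2)%N.
    by rewrite expnMn -expnM mulnC (_ : 4 = 2 ^ 2)%N // -expnM [(2 * i)%N]mulnC.
  by rewrite leq_exp2r // -ei.
rewrite big_mkcond [leqRHS]big_mkcond; apply: leq_sum => R _.
case: (boolP (R \in S)) => // RS; case: eqP => //= ci.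
have ei : cl R = i by rewrite -ci inordK.
by rewrite inE RS -ei clP.
Qed.

(** Of the [u2] hinges counted with multiplicity, at most half are degenerate
([E]) and at most a quarter of [D * B] are poor ([a * x] over [w] for each of
the [B] planes); the rest is bounded by [T], the contribution of the rich
planes. *)
Lemma hinge_arith (w u2 E T x a A B tau D : rat) :
  0 < w -> 0 < A -> 0 <= B -> 0 <= D -> 0 < E -> 0 <= tau ->
  w * u2 <= w * (T + E) + B * (a * x) -> E ^+ 2 <= A * u2 -> tau * B <= E ->
  2 * A <= E -> D * A <= tau ^+ 2 * B -> 4 * (a * x) <= D * w -> D * B <= 4 * T.
Proof.
move=> w0 A0 B0 D0 E0 tau0 h1 h2 h3 h4 h5 h6.
have u_ge : D * B <= u2.
  rewrite -(ler_pM2l A0); apply: le_trans h2.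
  apply: le_trans (_ : (tau * B) ^+ 2 <= _); last by rewrite lerXn2r ?nnegrE ?mulr_ge0 // ltW.
  have := ler_wpM2r B0 h5; lra.
have E_le : 2 * E <= u2.
  have u0 : 0 <= u2 by apply: le_trans u_ge; rewrite mulr_ge0.
  rewrite -(ler_pM2l E0); have := ler_wpM2r u0 h4; lra.
have h7 := ler_wpM2l B0 h6.
have : w * (D * B) <= w * (4 * T).
  have := ler_wpM2l (ltW w0) E_le; have := ler_wpM2l (ltW w0) u_ge; lra.
by rewrite ler_pM2l.
Qed.

(** With [t] close enough to 1, the total loss [t ^+ M] over all steps of the
climb costs less than one factor [q]. *)
Lemma theta_pow_ge1 (t q : rat) (M e : nat) :
  0 < t -> 0 < q -> (0 < e)%N -> 1 / 2 <= t ^+ e -> 2 ^+ M <= q ^+ e -> 1 <= t ^+ M * q.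
Proof.
move=> t0 q0 e0 te hM; have tq0 : 0 < t ^+ M * q by rewrite mulr_gt0 ?exprn_gt0.
rewrite leNgt; apply/negP => lt1.
have : (t ^+ M * q) ^+ e < 1 by rewrite exprn_ilt1 ?ltW // -lt0n.
rewrite exprMn exprAC => h.
have h1 : (1 / 2) ^+ M <= (t ^+ e) ^+ M.
  apply: lerXn2r => //; rewrite nnegrE; exact/exprn_ge0/ltW.
have h2 : (1 / 2) ^+ M * 2 ^+ M <= (t ^+ e) ^+ M * q ^+ e.
  by apply: ler_pM => //; apply: exprn_ge0; lra.
move: h2; rewrite -exprMn (_ : 1 / 2 * 2 = 1) ?expr1n; [lra | lra].
Qed.

(** * Climbing from planes to planes of one more dimension *)

Local Open Scope ring_scope.


Lemma kap_decay (kap : rat) j : 0 <= kap -> kap <= 1 -> kap * (16 / 4 ^+ j.+2) <= 1.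
Proof.
move=> k0 k1; have p4 : 1 <= 4 ^+ j :> rat by rewrite exprn_ege1.
have p40 : 0 < 4 ^+ j :> rat by rewrite exprn_gt0.
have -> : kap * (16 / 4 ^+ j.+2) = kap / 4 ^+ j.
  by rewrite !exprS; field; rewrite gt_eqF.
by rewrite ler_pdivrMr // mul1r (le_trans k1).
Qed.

Section Chain.
Variables (F : finFieldType) (n : nat).
Implicit Types (X : {set 'rV[F]_n}) (A B : {set {set 'rV[F]_n}}).
Local Notation q := #|F|.

(** The state of the climb at planes of dimension [j.+1].  The ratio
[tau ^+ 2 * #|B| / #|A|] is the number of hinges per member of [B]; it stays
above [C0 * q ^+ d], up to constants and the accumulated dyadic loss [t ^+ M].
The last bound is the count of [B]: its exponent [j * j + 3 * j] is the sum of
[2 * i.+1] for [i] from 1 to [j], one term for each step taken, and the factor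
[t ^+ (M * (d - j.+1))] on the larger side is the surplus in [#|B|] that is kept
to pay, in each of the [d - j.+1] remaining steps, for the loss [t ^+ M] in the
number of hinges. *)
Definition chain (t kap C0 : rat) (a d j : nat) X (N : nat) A B (tau : rat) (M : nat) :=
  [/\ (forall Q, Q \in A -> is_plane j Q) /\ dense_planes j.+1 a X B,
      0 < tau /\ (forall L, L \in B -> tau <= #|subplanes_of A L|%:R),
      (2 ^ M <= q ^ (2 * d * j))%N,
      kap * C0 * t ^+ M * q%:R ^+ d * #|A|%:R <= tau ^+ 2 * #|B|%:R &
      kap * N%:R * q%:R ^+ (j * d) <=
        #|B|%:R * t ^+ (M * (d - j.+1)) * q%:R ^+ (j * j + 3 * j)].

Lemma sum_incidences A B :
  (\sum_(Q in A) #|[set L in B | Q \subset L]| = \sum_(L in B) #|subplanes_of A L|)%N.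
Proof.
under eq_bigr do rewrite -sum_mem_card.
by rewrite exchange_big; apply: eq_bigr => L _; rewrite sum_mem_card.
Qed.

(** One step of the climb.  The rich planes receive at least a quarter of the
hinges; a dyadic class of them, of multiplicity about [V / 2 ^+ i], becomes the
new family.  The bound on [C0 * #|X|] is what makes poor hinges negligible. *)
Lemma chain_step (t kap C0 : rat) (a d j : nat) X (N : nat) A B tau M :
  0 < t < 1 -> 1 / 2 <= t ^+ (2 * (d * d)) -> 0 < kap <= 1 -> 1 <= C0 ->
  (j.+2 <= d)%N -> (2 * a <= q)%N -> (0 < N)%N ->
  2 ^+ j.+1 <= kap * C0 -> 4 * (2 * a + 2 * a * (2 * a))%N%:R <= kap * C0 ->
  C0 * #|X|%:R <= q%:R ^+ d.+1 ->
  chain t kap C0 a d j X N A B tau M ->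
  exists B' tau' M',
    chain t ((1 - t) * kap ^+ 2 / 4 ^+ j.+2) C0 (a + a * a) d j.+1 X N B B' tau' M'.
Proof.
move=> t01 te /andP [k0 k1] C01 jd aq N0 hC1 hC2 hX [[hA hB] [tau0 htau] hM hD hx].
have /andP [t0 t1] := t01; set Q := q%:R in hX hD hx *.
have q1 : 1 < Q :> rat by rewrite ltr1n field_card_gt1.
have q0 : 0 < Q by apply: lt_trans q1.
have [B0|[L0 L0B]] := set_0Vmem B.
  move: hx; rewrite B0 cards0 !mul0r leNgt; case/negP.
  by rewrite !mulr_gt0 ?exprn_gt0 ?ltr0n ?field_card_gt0.
have cB : 0 < #|B|%:R :> rat by rewrite ltr0n; apply/card_gt0P; exists L0.
have cA : 0 < #|A|%:R :> rat.
  rewrite ltr0n; apply: leq_trans (_ : 0 < #|subplanes_of A L0|)%N _.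
    by have := lt_le_trans tau0 (htau _ L0B); rewrite ltr0n.
  by apply/subset_leq_card/subsetP => P; rewrite inE => /andP [].
have tauV : tau <= 2 ^+ j * Q ^+ j.+1.
  apply: le_trans (htau _ L0B) _; rewrite -!natrX -natrM ler_nat.
  apply: (@count_subplanes _ _ j L0); first by case: (hB _ L0B).
  by move=> L; rewrite inE => /andP [/hA].
have tM0 : 0 < t ^+ M by rewrite exprn_gt0.
have tMq : 1 <= t ^+ M * Q.
  have e0 : (0 < 2 * (d * d))%N by clear -jd; nia.
  apply: (theta_pow_ge1 t0 q0 e0 te).
  rewrite -!natrX ler_nat; apply: leq_trans hM _.
  by rewrite leq_exp2l ?field_card_gt1 // -mulnA leq_mul2l leq_mul2l; clear -jd; lia.
(* No dyadic loss has occurred before the first step, where there is no factor [Q] to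
   spare. *)
have tMqj : 1 <= t ^+ M * Q ^+ j.
  case: j jd hM {hC1 hD hx hA hB tauV} => [|j] jd hM.
    move: hM; rewrite muln0 expn0; case: M {tM0 tMq} => // M; rewrite expnS mul2n.
    by have : (0 < 2 ^ M)%N := expn_gt0 2 M; case: (2 ^ M)%N.
  rewrite exprS mulrA -[1]mulr1; apply: ler_pM => //.
  by rewrite exprn_ege1 // ltW.
set D := kap * C0 * t ^+ M * Q ^+ d in hD.
have D0 : 0 < D by rewrite !mulr_gt0 ?exprn_gt0 //; apply: lt_le_trans C01.
pose E := (\sum_(P in A) #|[set L in B | P \subset L]|)%N.
pose T := (\sum_(R in rich j.+2 B) #|subplanes_of B R| ^ 2)%N.
have tauE : tau * #|B|%:R <= E%:R.
  rewrite /E sum_incidences natr_sum mulrC mulr_natl -sumr_const.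
  by apply: ler_sum => L /htau.
have E2A : 2 * #|A|%:R <= E%:R :> rat.
  apply: le_trans tauE; rewrite -(ler_pM2l tau0).
  have h1 : tau * (2 * #|A|%:R) <= 2 ^+ j * Q ^+ j.+1 * (2 * #|A|%:R).
    by rewrite ler_wpM2r // mulr_ge0 // ltW.
  apply: le_trans h1 _; apply: le_trans (_ : D * #|A|%:R <= _); last by move: hD; clear; lra.
  rewrite mulrA; apply: ler_wpM2r; first exact: ltW.
  rewrite /D (_ : d = (d - j.+2) + j.+1 + 1)%N; last by clear -jd; lia.
  rewrite !exprD expr1; set Qe := Q ^+ (d - j.+2).
  have Qe1 : 1 <= Qe by rewrite exprn_ege1 // ltW.
  have h2 : 2 ^+ j.+1 * 1 <= kap * C0 * (t ^+ M * Q) by apply: ler_pM => //; exact: exprn_ge0.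
  have h3 : 2 ^+ j.+1 * 1 * 1 <= kap * C0 * (t ^+ M * Q) * Qe.
    by apply: ler_pM => //; rewrite mulr1 exprn_ge0.
  have Qj : 0 <= Q ^+ j.+1 by rewrite exprn_ge0 // ltW.
  have := ler_wpM2r Qj h3; rewrite (exprS 2 j); clear; lra.
have hT : D * #|B|%:R <= 4 * T%:R.
  apply: (@hinge_arith (Q ^+ j.+1) (\sum_(P in A) #|[set L in B | P \subset L]| ^ 2)%N%:R
     E%:R T%:R #|X|%:R (2 * a + 2 * a * (2 * a))%N%:R #|A|%:R #|B|%:R tau D) => //.
  - by rewrite exprn_gt0.
  - exact: ltW.
  - by apply: lt_le_trans tauE; rewrite mulr_gt0.
  - exact: ltW.
  - rewrite -natrX -!natrD -!natrM -!natrD ler_nat; exact: hinge_count.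
  - by rewrite -natrX -natrM ler_nat sum_sqr_leq.
  have C00 : 0 < C0 := lt_le_trans ltr01 C01.
  have h1 : C0 * #|X|%:R * (4 * (2 * a + 2 * a * (2 * a))%N%:R) <= Q ^+ d.+1 * (kap * C0).
    by apply: ler_pM => //; rewrite mulr_ge0 // ltW.
  have h2 : C0 * (4 * ((2 * a + 2 * a * (2 * a))%N%:R * #|X|%:R)) <= C0 * (kap * Q ^+ d.+1).
    by move: h1; clear; lra.
  rewrite ler_pM2l // in h2; apply: le_trans h2 _.
  have Qd : 0 <= kap * Q ^+ d.+1 by rewrite mulr_ge0 ?exprn_ge0 // ltW.
  have := ler_pM (ltW k0) ler01 (lexx kap) C01.
  rewrite /D => h3; have h4 : 1 <= C0 * (t ^+ M * Q ^+ j).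
    by rewrite -[1]mulr1; apply: ler_pM.
  have := ler_wpM2l Qd h4; rewrite (exprS _ d) (exprS _ j); clear; lra.
(* At least a quarter of the [D] hinges per plane are rich, so some rich plane exists. *)
have T0 : (0 < T)%N.
  by rewrite -(ltr0n rat); move: hT (mulr_gt0 D0 cB); clear; lra.
pose V := (2 ^ j.+1 * q ^ j.+2)%N.
have hv R : R \in rich j.+2 B -> (0 < #|subplanes_of B R| <= V)%N.
  rewrite inE => /andP [/asboolP hR hq]; rewrite (leq_trans _ hq) ?field_card_gt0 //=.
  apply: (count_subplanes hR) => L; rewrite inE => /andP [/hB []] //.
have [i hi] := dyadic_pigeonhole t01 hv T0.
set B' := [set R in _ | _] in hi.
have hrD := rich_dense hB.
have BB R : R \in B' -> [/\ R \in rich j.+2 B, (q <= #|subplanes_of B R|)%N,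
    (2 ^ i * #|subplanes_of B R| <= V)%N & (V < 2 ^ i.+1 * #|subplanes_of B R|)%N].
  by rewrite !inE => /andP [/andP [-> ->] /andP []].
have p0 : 0 < 4 ^+ i :> rat by rewrite exprn_gt0.
have ti0 : 0 < t ^+ i by rewrite exprn_gt0.
have omt : 0 < 1 - t by rewrite subr_gt0.
have c0 : 0 < (1 - t) * t ^+ i * 4 ^+ i := mulr_gt0 (mulr_gt0 omt ti0) p0.
have hB' : (1 - t) * t ^+ i * 4 ^+ i * (D * #|B|%:R) <= 4 * (#|B'|%:R * V%:R ^+ 2).
  have := ler_wpM2l (ltW c0) hT; have := hi; rewrite -/T; clear; lra.
have cB' : (0 < #|B'|)%N.
  rewrite lt0n; apply/eqP => e; move: hB'; rewrite e mul0r mulr0 leNgt.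
  by rewrite (mulr_gt0 c0 (mulr_gt0 D0 cB)).
exists B', (V%:R / 2 ^+ i.+1), (M + i)%N; split.
- split; last by move=> R /BB [/hrD].
  by move=> L /hB [].
- split; first by rewrite divr_gt0 ?exprn_gt0 // ltr0n muln_gt0 !expn_gt0 field_card_gt0.
  move=> R /BB [_ _ _ h]; rewrite ler_pdivrMr ?exprn_gt0 // -natrX -natrM ler_nat.
  by rewrite mulnC ltnW.
- have /card_gt0P [R /BB [_ h1 h2 _]] := cB'.
  have h3 : (2 ^ i * q <= q ^ j.+1 * q ^ j.+1 * q)%N.
    apply: leq_trans (leq_mul (leqnn _) h1) _; apply: leq_trans h2 _.
    by rewrite /V (expnSr q j.+1) mulnA !leq_mul // leq_exp2r ?field_card_gt1.
  rewrite leq_pmul2r ?field_card_gt0 // -expnD in h3.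
  rewrite mulnS [(2 * d + _)%N]addnC (expnD 2 M) (expnD q (2 * d * j)).
  apply: leq_mul hM _; apply: leq_trans h3 _.
  by rewrite leq_exp2l ?field_card_gt1 //; clear -jd; lia.
- set s := #|B'|%:R; rewrite expr_div_n -exprM.
  rewrite (_ : 2 ^+ (i.+1 * 2) = 4 * 4 ^+ i); last first.
    by rewrite mulnC exprM (_ : 2 ^+ 2 = 4) ?exprS //; lra.
  have p1 : 4 * 4 ^+ i != 0 :> rat by rewrite mulf_neq0 // gt_eqF.
  rewrite -(ler_pM2l (_ : 0 < 4 * (4 * 4 ^+ i))); last by rewrite !mulr_gt0.
  have -> : 4 * (4 * 4 ^+ i) * (V%:R ^+ 2 / (4 * 4 ^+ i) * s) = 4 * (s * V%:R ^+ 2).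
    by field; rewrite gt_eqF.
  apply: le_trans hB'; rewrite exprD.
  have g0 := ltW (mulr_gt0 c0 (mulr_gt0 D0 cB)).
  have k16 := kap_decay j (ltW k0) k1.
  have := ler_wpM2l g0 k16; rewrite /D; clear; lra.
- have [e de] : exists e, (d = e + j.+2)%N by exists (d - j.+2)%N; clear -jd; lia.
  have -> : (d - j.+2 = e)%N by clear -de; lia.
  have ed : (d - j.+1 = e.+1)%N by clear -de; lia.
  rewrite ed in hx; set s := #|B'|%:R in hB' *.
  have eV : V%:R ^+ 2 = 4 ^+ j.+1 * Q ^+ (2 * j + 4).
    rewrite /V natrM !natrX exprMn -!exprM mulnC exprM (_ : 2 ^+ 2 = 4); last by lra.
    by congr (_ * _ ^+ _); clear; lia.
  (* The gain [4 ^+ i] in the number of planes outweighs the loss [t ^+ i] in all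
     remaining steps. *)
  have b0 : 0 <= 4 ^+ i * t ^+ (i * e.+1) - 1.
    rewrite mulnC exprM -exprMn subr_ge0 exprn_ege1 //.
    have : t ^+ (2 * (d * d)) <= t ^+ e.+1.
      by rewrite ler_wiXn2l ?ltW //; clear -de; nia.
    by lra.
  rewrite eV in hB'.
  set Z := t ^+ ((M + i) * e) * Q ^+ (j * j + 3 * j).
  have Z0 : 0 <= Z by rewrite mulr_ge0 // exprn_ge0 // ltW.
  have h1 := ler_wpM2r Z0 hB'.
  have -> : (j.+1 * j.+1 + 3 * j.+1 = (2 * j + 4) + (j * j + 3 * j))%N by clear; lia.
  rewrite mulSn addnC.
  set y := _ * t ^+ (M * e.+1) * _ in hx.
  have e1 : (1 - t) * t ^+ i * 4 ^+ i * (D * #|B|%:R) * Z =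
     (1 - t) * (kap * C0) * Q ^+ d * (4 ^+ i * t ^+ (i * e.+1)) * y.
    rewrite /y /D /Z mulnDl !mulnS !exprD; ring.
  rewrite e1 in h1.
  have y0 : 0 <= y by rewrite /y !mulr_ge0 ?exprn_ge0 // ltW.
  have g0 : 0 <= (1 - t) * kap * Q ^+ d.
    exact: mulr_ge0 (mulr_ge0 (ltW omt) (ltW k0)) (exprn_ge0 _ (ltW q0)).
  have h2 : (1 - t) * kap * Q ^+ d * (1 * (kap * N%:R * Q ^+ (j * d))) <=
      (1 - t) * kap * Q ^+ d * ((C0 * (4 ^+ i * t ^+ (i * e.+1))) * y).
    apply: ler_wpM2l => //; apply: ler_pM => //.
      by rewrite !mulr_ge0 ?exprn_ge0 // ltW.
    by rewrite -[1]mulr1; apply: ler_pM => //; lra.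
  have h3 : (1 - t) * kap ^+ 2 * (N%:R * Q ^+ (j * d + d)) <=
     4 ^+ j.+2 * (s * Q ^+ (2 * j + 4) * Z).
    rewrite exprD (exprS _ j.+1); move: h1 h2; clear; lra.
  rewrite (exprD Q (2 * j + 4)) [X in _ <= X](_ : _ = s * Q ^+ (2 * j + 4) * Z); last first.
    by rewrite /Z; ring.
  have p4 : 0 < 4 ^+ j.+2 :> rat by rewrite exprn_gt0.
  rewrite -(ler_pM2l p4); apply: le_trans h3.
  rewrite le_eqVlt; apply/orP; left; apply/eqP; field; rewrite gt_eqF //.
Qed.

End Chain.

(** * Unions of lines *)

Local Open Scope ring_scope.

Lemma bernoulli (x : rat) m : 0 <= x <= 1 -> 1 - m%:R * x <= (1 - x) ^+ m.
Proof.
move=> /andP [x0 x1]; elim: m => [|m IH]; first by rewrite mul0r subr0.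
rewrite exprS mulrSr; have h : 0 <= 1 - x by rewrite subr_ge0.
have := ler_wpM2l h IH; have : 0 <= m%:R * x * x by rewrite !mulr_ge0.
by clear; lra.
Qed.

(** The climb starts with the points of [X] below the lines [LL].  The threshold [C]
for [C0] is raised at every step, while [kap] and the density [b] do not depend
on [C0]. *)
Lemma chain_exists (t : rat) (d a j : nat) :
  0 < t < 1 -> 1 / 2 <= t ^+ (2 * (d * d)) -> (0 < a)%N -> (j < d)%N ->
  exists (kap C : rat) (b Q0 : nat), [/\ 0 < kap <= 1, 1 <= C &
    forall C0, C <= C0 -> forall (F : finFieldType) n (X : {set 'rV[F]_n}) LL,
      dense_planes 1 a X LL -> (0 < #|LL|)%N -> (Q0 <= #|F|)%N ->
      C0 * #|X|%:R * #|F|%:R ^+ d <= #|LL|%:R * #|F|%:R ^+ 2 ->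
      C0 * #|X|%:R <= #|F|%:R ^+ d.+1 ->
      exists A B tau M, chain t kap C0 b d j X #|LL| A B tau M].
Proof.
move=> t01 te a0; elim: j => [|j IH] jd.
  have a1 : 1 <= a%:R :> rat by rewrite ler1n.
  have a20 : 0 < a%:R ^+ 2 :> rat by rewrite exprn_gt0 ?ltr0n.
  exists (1 / a%:R ^+ 2), 1, a, 0%N; split => //.
    by rewrite divr_gt0 //= ler_pdivrMr // mul1r exprn_ege1.
  move=> C0 C01 F n X LL hLL LL0 _ h1 h2.
  exists [set [set x] | x in X], LL, (#|F|%:R / a%:R), 0%N; split.
  - split=> // Q /imsetP [x _ ->]; exact: plane_set1.
  - split; first by rewrite divr_gt0 ?ltr0n ?field_card_gt0.
    move=> L /hLL [_ hL]; rewrite ler_pdivrMr ?ltr0n // -natrM ler_nat mulnC.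
    rewrite expn1 in hL; apply: leq_trans hL _; rewrite leq_mul2l; apply/orP; right.
    rewrite -(card_imset (X :&: L) set1_inj); apply: subset_leq_card.
    apply/subsetP => P /imsetP [x]; rewrite inE => /andP [xX xL] ->.
    by rewrite inE sub1set xL andbT; apply/imsetP; exists x.
  - by rewrite muln0 !expn0.
  - set A := [set _ | _ in _]; have cA : #|A|%:R <= #|X|%:R :> rat.
      by rewrite ler_nat leq_imset_card.
    have -> : 1 / a%:R ^+ 2 * C0 * t ^+ 0 * #|F|%:R ^+ d * #|A|%:R =
      1 / a%:R ^+ 2 * (C0 * #|A|%:R * #|F|%:R ^+ d) by rewrite expr0; ring.
    have -> : (#|F|%:R / a%:R) ^+ 2 * #|LL|%:R =
      1 / a%:R ^+ 2 * (#|LL|%:R * #|F|%:R ^+ 2) :> rat by rewrite expr_div_n; ring.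
    apply: ler_wpM2l; first by rewrite mul1r invr_ge0 ltW.
    apply: le_trans h1; apply: ler_wpM2r; first exact: exprn_ge0.
    by apply: ler_wpM2l => //; exact: le_trans C01.
  rewrite !mul0n !muln0 !expr0 !mulr1 ler_piMl // ler_pdivrMr // mul1r.
  exact: exprn_ege1.
have [kap [C [b [Q0 [hk C1 IHj]]]]] := IH (ltnW jd).
have /andP [k0 k1] := hk; have /andP [t0 t1] := t01.
set b2 := (2 * b + 2 * b * (2 * b))%N.
have u1 : 0 <= 2 ^+ j.+1 / kap by apply: divr_ge0 (exprn_ge0 _ _) (ltW k0).
have u2 : 0 <= 4 * b2%:R / kap by apply: divr_ge0 (mulr_ge0 _ _) (ltW k0).
exists ((1 - t) * kap ^+ 2 / 4 ^+ j.+2), (C + 2 ^+ j.+1 / kap + 4 * b2%:R / kap).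
exists (b + b * b)%N, (Q0 + 2 * b)%N; split.
- have p4 : 0 < 4 ^+ j.+2 :> rat by rewrite exprn_gt0.
  apply/andP; split.
    by apply: divr_gt0 p4; apply: mulr_gt0; rewrite ?subr_gt0 // exprn_gt0.
  rewrite ler_pdivrMr // mul1r.
  apply: (@le_trans _ _ 1); last by rewrite exprn_ege1.
  apply: mulr_ile1; [by rewrite subr_ge0 ltW | exact/exprn_ge0/ltW | |].
    by rewrite gerBl ltW.
  by apply: exprn_ile1 => //; exact: ltW.
- by rewrite -addrA (le_trans C1) // lerDl addr_ge0.
move=> C0 hC F n X LL hLL LL0 hq h1 h2.
have hC' : C <= C0 by apply: le_trans hC; rewrite -addrA lerDl addr_ge0.
have [A [B [tau [M hch]]]] :=
  IHj C0 hC' F n X LL hLL LL0 (leq_trans (leq_addr _ _) hq) h1 h2.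
exists B.
apply: (chain_step t01 te hk _ jd _ LL0 _ _ h2 hch).
- exact: le_trans hC'.
- exact: leq_trans (leq_addl _ _) hq.
- rewrite [kap * _]mulrC -ler_pdivrMr //; apply: le_trans hC.
  by rewrite addrAC lerDr addr_ge0 // (le_trans ler01).
- rewrite [kap * _]mulrC -ler_pdivrMr //; apply: le_trans hC.
  by rewrite lerDr addr_ge0 // (le_trans ler01).
Qed.

Local Close Scope ring_scope.
Local Open Scope nat_scope.

(** Either [#|LL| * q ^ 2] is at most a constant times [#|X| * q ^ e.+1], which is
the claim, or the climb succeeds for [d = e.+1] and ends with so many dense
[d]-planes that their union already has the required size.  Small fields are
absorbed in the constant. *)
Lemma lines_union e a :
  exists C, forall (F : finFieldType) n (X : {set 'rV[F]_n}) LL,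
    dense_planes 1 a X LL ->
    minn #|LL| (#|F| ^ (2 * e + 1)) * #|F| ^ e.+1 <= C * #|X| * #|F| ^ (2 * e).
Proof.
have [->|a0] := posnP a.
  exists 0 => F n X LL hLL; have -> : LL = set0; last by rewrite cards0 min0n.
  apply/setP => L; rewrite inE; apply/negP => /hLL [_].
  by rewrite mul0n expn1 leqNgt field_card_gt0.
have [y y1 ey] : exists2 y : rat, (1 <= y)%R & ((e.+1 * e.+1)%N%:R = y)%R.
  by exists ((e.+1 * e.+1)%N%:R)%R; rewrite // ler1n.
have y0 : (0 < y)%R by apply: lt_le_trans y1; exact: ltr01.
pose t : rat := (1 - 1 / (4 * y))%R.
have x0 : (0 < 1 / (4 * y))%R by rewrite divr_gt0 ?mulr_gt0.
have x1 : (1 / (4 * y) < 1)%R by rewrite ltr_pdivrMr ?mulr_gt0 // mul1r; move: y1; clear; lra.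
have t01 : (0 < t < 1)%R by apply/andP; split; move: x0 x1; rewrite /t; clear; lra.
have te : (1 / 2 <= t ^+ (2 * (e.+1 * e.+1)))%R.
  apply: le_trans (bernoulli _ _); last by rewrite !ltW.
  rewrite natrM ey (_ : (1 - 2 * y * (1 / (4 * y)) = 1 / 2)%R) //.
  by field; rewrite gt_eqF.
have [kap [C0 [b [Q0 [/andP [k0 k1] C01 hch]]]]] := chain_exists t01 te a0 (ltnSn e).
pose C1 := Num.bound C0; pose C2 := Num.bound ((b + b * b)%N%:R / kap)%R.
exists (Q0 ^ (3 * e + 2) + C1 + C2) => F n X LL' hLL'.
have [LL sLL cLL] := exists_subset_card (geq_minl #|LL'| (#|F| ^ (2 * e + 1))).
rewrite -cLL; have hLL : dense_planes 1 a X LL by move=> L /(subsetP sLL) /hLL'.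
have cN : #|LL| <= #|F| ^ (2 * e + 1) by rewrite cLL geq_minr.
set q := #|F| in cN *; have q0 : 0 < q := field_card_gt0 F.
have [->|LL0] := posnP #|LL|; first by [].
have X0 : 0 < #|X|.
  have /card_gt0P [L /hLL [_ h]] := LL0; rewrite lt0n; apply/eqP => /eqP.
  rewrite cards_eq0 => /eqP X0; move: h; rewrite X0 set0I cards0 muln0 expn1.
  by rewrite leqNgt q0.
(* In a small field the number of lines counted is bounded. *)
have [qQ|Qq] := leqP q Q0.
  apply: leq_trans (leq_mul cN (leqnn _)) _; rewrite -expnD.
  apply: leq_trans (_ : Q0 ^ (3 * e + 2) <= _).
    by rewrite (_ : 2 * e + 1 + e.+1 = 3 * e + 2) ?leq_exp2r //; lia.
  rewrite -mulnA -[leqLHS]muln1; apply: leq_mul.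
    by rewrite -addnA leq_addr.
  by rewrite muln_gt0 X0 expn_gt0 q0.
have [h1|h1] := lerP (C0 * #|X|%:R * q%:R ^+ e.+1)%R (#|LL|%:R * q%:R ^+ 2)%R; last first.
  have hC1 : (C0 <= C1%:R)%R.
    by apply/ltW/archi_boundP; apply: le_trans C01.
  have : (#|LL|%:R * q%:R ^+ 2 <= C1%:R * #|X|%:R * q%:R ^+ e.+1 :> rat)%R.
    apply: le_trans (ltW h1) _; apply: ler_wpM2r; first exact: exprn_ge0.
    exact: ler_wpM2r.
  rewrite -!natrX -!natrM ler_nat => h2.
  rewrite -(leq_pmul2r (_ : 0 < q ^ e.+1)) ?expn_gt0 ?q0 //.
  apply: (@leq_trans (C1 * #|X| * q ^ e.+1 * q ^ (2 * e))).
    rewrite -mulnA -expnD (_ : e.+1 + e.+1 = 2 + 2 * e); last by clear; lia.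
    by rewrite expnD mulnA leq_mul2r h2 orbT.
  rewrite mulnAC leq_mul2r leq_mul2r leq_mul2r; apply/orP; right; apply/orP; right.
  apply/orP; right; rewrite -addnA addnCA; exact: leq_addr.
have h2 : (C0 * #|X|%:R <= q%:R ^+ e.+2)%R.
  have qp : (0 < q%:R ^+ e.+1 :> rat)%R by rewrite exprn_gt0 // ltr0n.
  rewrite -(ler_pM2r qp); apply: le_trans h1 _.
  rewrite -!natrX -!natrM ler_nat; apply: leq_trans (leq_mul cN (leqnn _)) _.
  by rewrite -!expnD (_ : 2 * e + 1 + 2 = e.+2 + e.+1) //; clear; lia.
have [A [B [tau [M [[_ hB] _ _ _ hx]]]]] := hch C0 (lexx _) F n X LL hLL LL0 (ltnW Qq) h1 h2.
have /(_ (fun L _ => subsetIl _ _)) hU := union_dense_planes (U := X) hB.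
rewrite subnn muln0 expr0 mulr1 in hx.
have hkN : (kap * #|LL|%:R <= (minn #|B| q)%:R * q%:R ^+ (2 * e))%R.
  have qe : (0 < q%:R ^+ (e * e.+1) :> rat)%R by rewrite exprn_gt0 // ltr0n.
  case: (leqP #|B| q) => hBq.
    rewrite -(ler_pM2r qe); apply: le_trans hx _.
    by rewrite -mulrA -exprD (_ : 2 * e + e * e.+1 = e * e + 3 * e) //; clear; lia.
  rewrite -exprS; apply: (@le_trans _ _ (#|LL|%:R)%R); first by rewrite ler_piMl.
  by rewrite -natrX ler_nat; rewrite addn1 in cN.
have hC2 : ((b + b * b)%N%:R / kap <= C2%:R)%R.
  by apply/ltW/archi_boundP; apply: divr_ge0 (ltW k0).
have hkN' : (kap * (#|LL| * q ^ e.+1)%N%:R <= (b + b * b)%N%:R * (#|X| * q ^ (2 * e))%N%:R)%R.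
  move: hU; rewrite -(ler_nat rat) !natrM natrX => hU.
  have qe : (0 <= q%:R ^+ e.+1 :> rat)%R by apply: exprn_ge0.
  have q2e : (0 <= q%:R ^+ (2 * e) :> rat)%R by apply: exprn_ge0.
  have := ler_wpM2r qe hkN; have := ler_wpM2r q2e hU; rewrite !natrX.
  by clear; lra.
have : (#|LL| * q ^ e.+1 <= C2 * (#|X| * q ^ (2 * e))).
  rewrite -(ler_nat rat) (natrM _ C2) -(ler_pM2l k0); apply: le_trans hkN' _.
  rewrite mulrA; apply: ler_wpM2r => //.
  by rewrite mulrC -ler_pdivrMr.
move=> h3; apply: leq_trans h3 _; rewrite mulnA !leq_mul2r leq_addl.
by rewrite !orbT.
Qed.

(** * The planes through a point *)

Local Open Scope nat_scope.

Section Link.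
Variables (F : finFieldType) (n : nat).
Implicit Types (P Q R L M X Y Z U : {set 'rV[F]_n}) (x y p w : 'rV[F]_n) (k m j : nat).
Implicit Types (A B LL LP : {set {set 'rV[F]_n}}).
Local Notation q := #|F|.

Definition shadow k LL := \bigcup_(L in LL) planes_in k L.

Lemma shadowP k LL P :
  reflect (exists2 L, L \in LL & is_plane k P /\ P \subset L) (P \in shadow k LL).
Proof.
apply: (iffP bigcupP) => [[L LLL]|[L LLL [hP sPL]]].
  by rewrite inE => /andP [/asboolP hP sPL]; exists L.
by exists L => //; rewrite inE sPL andbT; apply/asboolP.
Qed.

Definition form p w x : F := (((x - p) *m w^T) 0 0)%R.
Definition cut p w := [set x | form p w x == 1%R].

Lemma cut_notin p w : p \notin cut p w.
Proof. by rewrite inE /form subrr mul0mx mxE eq_sym oner_eq0. Qed.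

(** The equation [form p w x = 1] drops the dimension by one as soon as the form is
not identically 0 on [L]: the direction space becomes the kernel of the form on
that of [L], and rescaling [x - p] gives a point on the cut. *)
Lemma plane_cut k p w L x :
  is_plane k.+1 L -> p \in L -> x \in L -> form p w x != 0%R ->
  is_plane k (L :&: cut p w).
Proof.
move=> hL pL xL fx; have [V dV hV] := plane_at hL pL.
pose f : 'Hom('rV[F]_n, 'rV[F]_1) := linfun (mulmxr (w^T : 'M_(n, 1))%R).
have fE u : f u = (u *m w^T)%R by rewrite lfunE.
have ker u : (u \in lker f) = ((u *m w^T)%R 0%R 0%R == 0%R).
  rewrite memv_ker fE; apply/eqP/eqP => [->|h]; first by rewrite mxE.
  by apply/matrixP => i i'; rewrite !ord1 h mxE.
have dimI : \dim (V :&: lker f) = k.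
  have := limg_ker_dim f V; rewrite dV.
  have le1 : \dim (f @: V) <= 1.
    by apply: leq_trans (dimvS (subvf _)) _; rewrite dimvf dim_matrix.
  have gt0 : 0 < \dim (f @: V).
    rewrite lt0n dimv_eq0; apply/eqP => e0.
    have := memv_img f (_ : (x - p)%R \in V); rewrite -hV => /(_ xL).
    rewrite e0 memv0 fE => /eqP h; move: fx; rewrite /form h mxE eqxx //.
  have -> : \dim (f @: V) = 1 by apply/eqP; rewrite eqn_leq le1.
  by rewrite addn1 => -[].
pose x1 := (p + (form p w x)^-1 *: (x - p))%R.
apply: (@plane_of _ _ _ x1 (V :&: lker f)%VS) => // y.
have V1 : (x1 - p \in V)%R by rewrite addrAC subrr add0r memvZ // -hV.
have f1 : ((x1 - p) *m w^T)%R 0%R 0%R = 1%R.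
  by rewrite addrAC subrr add0r -scalemxAl mxE -/(form p w x) mulVf.
have ey : (y - x1 = (y - p) - (x1 - p))%R by rewrite opprB addrA subrK.
have e3 : ((y - x1) *m w^T)%R 0%R 0%R = (form p w y - 1)%R.
  by rewrite ey mulmxBl mxE; congr (_ + _)%R; rewrite mxE f1.
rewrite !inE hV memv_cap ker e3 subr_eq0; congr (_ && _).
apply/idP/idP => [h|h]; first by rewrite ey memvB.
by rewrite -(subrK (x1 - p)%R (y - p)%R) -ey memvD.
Qed.

(** Adding a fixed unit vector to [w] turns every form vanishing at [x] into one
that does not. *)
Lemma form_half p x : x != p ->
  #|{: 'rV[F]_n}| <= 2 * #|[set w | form p w x != 0%R]|.
Proof.
move=> xp; have : (x - p != 0)%R by rewrite subr_eq0.
case/rV0Pn => i hi; pose g (w : 'rV[F]_n) := (w + delta_mx 0 i)%R.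
have <- := cardsC [set w | form p w x != 0%R]; rewrite mul2n -addnn leq_add2l.
rewrite -(card_imset _ (addIr (delta_mx 0 i)%R)); apply: subset_leq_card.
apply/subsetP => w /imsetP [v]; rewrite !inE negbK => /eqP v0 ->.
rewrite /form linearD mulmxDr mxE -/(form p v x) v0 add0r.
rewrite /= trmx_delta -colE mxE //.
Qed.

(** Some hyperplane avoiding [p] is parallel to at most half of the planes, by
averaging over all linear forms.  Cutting with it loses nothing else: a plane
through [p] is recovered from its cut as the span with [p], for members of the
family as well as for members of the shadow. *)
Lemma link_at_point p k k' LP :
  (forall L, L \in LP -> is_plane k.+1 L /\ p \in L) ->
  exists LL, [/\ forall L, L \in LL -> is_plane k L, #|LP| <= 2 * #|LL| &
    #|shadow k' LL| <= #|[set P in shadow k'.+1 LP | p \in P]|].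
Proof.
move=> hLP.
pose good w := [set L in LP | [exists x in L, form p w x != 0%R]].
have [w hw] : exists w, #|LP| <= 2 * #|good w|.
  apply/existsP; apply: contraT; rewrite negb_exists => /forallP hn.
  have : \sum_(w : 'rV[F]_n) 2 * #|good w| < \sum_(w : 'rV[F]_n) #|LP|.
    rewrite (bigD1 0%R) // [X in _ < X](bigD1 0%R) //= -addSn.
    apply: leq_add; first by rewrite ltnNge.
    by apply: leq_sum => w _; apply: ltnW; rewrite ltnNge.
  rewrite ltnNge -big_distrr /=; case/negP.
  under [X in _ <= _ * X]eq_bigr do rewrite /good -sum_mem_card.
  rewrite [X in _ <= _ * X]exchange_big sum_nat_const mulnC -sum_nat_const big_distrr /=.
  apply: leq_sum => L /hLP [hL pL].
  have /subsetPn [x xL] : ~~ (L \subset [set p]).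
    apply/negP => /subset_leq_card; rewrite cards1 (plane_card hL) leqNgt.
    by rewrite -{1}(expn0 q) ltn_exp2l ?field_card_gt1.
  rewrite inE => xp.
  apply: leq_trans (form_half xp) _; rewrite leq_mul2l /= -sum1_card big_mkcond /=.
  apply: leq_sum => w _; rewrite inE; case: ifP => // hx.
  by rewrite lt0b; apply/exists_inP; exists x.
have goodP L : L \in good w -> [/\ is_plane k.+1 L, p \in L & is_plane k (L :&: cut p w)].
  rewrite inE => /andP [/hLP [hL pL] /exists_inP [x xL hx]].
  split=> //; exact: plane_cut hx.
have joinE m Z P : is_plane m Z -> Z \subset cut p w -> is_plane m.+1 P -> p \in P ->
    Z \subset P -> forall j Q, is_plane j Q -> p \in Q -> Z \subset Q -> P \subset Q.
  move=> hZ sZ hP pP sZP j Q hQ pQ sZQ.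
  have pZ : p \notin Z by apply: contraNN (cut_notin p w); exact: (subsetP sZ).
  have [R [hR _ _ minR]] := plane_join hZ pZ.
  by rewrite -(plane_sub_eq hR hP (minR _ _ hP sZP pP) (leqnn _)); exact: minR hQ sZQ pQ.
exists [set L :&: cut p w | L in good w]; split.
- by move=> Z /imsetP [L /goodP [_ _ hZ] ->].
- rewrite card_in_imset // => L L' /goodP [hL pL hZ] /goodP [hL' pL' hZ'] e.
  apply: (plane_sub_eq hL hL') => //.
  apply: (joinE _ _ _ hZ) hL' pL' _ => //; [exact: subsetIr | exact: subsetIl |].
  by rewrite e subsetIl.
apply: leq_trans (leq_imset_card (fun P => P :&: cut p w) _).
apply/subset_leq_card/subsetP => Z /shadowP [_ /imsetP [L Lg ->] [hZ]].
rewrite subsetI => /andP [sZL sZc]; have [hL pL _] := goodP _ Lg.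
have pZ : p \notin Z by apply: contraNN (cut_notin p w); exact: (subsetP sZc).
have [P [hP sZP pP minP]] := plane_join hZ pZ.
have sPL : P \subset L := minP _ _ hL sZL pL.
apply/imsetP; exists P.
  rewrite inE pP andbT; apply/shadowP; exists L => //.
  by move: Lg; rewrite inE => /andP [].
have [x xZ] := plane_inh hZ.
have fx : form p w x != 0%R.
  by move: (subsetP sZc _ xZ); rewrite inE => /eqP ->; exact: oner_neq0.
apply: (plane_sub_eq hZ (plane_cut hP pP (subsetP sZP _ xZ) fx)) => //.
by rewrite subsetI sZP.
Qed.

End Link.

(** * Points lying on too many planes *)

Local Open Scope nat_scope.

Section HeavyPoints.
Variables (F : finFieldType) (n : nat).
Implicit Types (P Q R L M X Y Z U : {set 'rV[F]_n}) (x y p w : 'rV[F]_n) (k m j : nat).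
Implicit Types (A B LL LP : {set {set 'rV[F]_n}}).
Local Notation q := #|F|.


Definition dense_lines a Y := [set l | `[< is_plane 1 l >] & q <= a * #|Y :&: l|].

Lemma dense_linesP a Y : dense_planes 1 a Y (dense_lines a Y).
Proof. by move=> l; rewrite inE expn1 => /andP [/asboolP]. Qed.

(** Two distinct points of [L] lie on a line inside [L]; the last term accounts for
the pairs of equal points. *)
Lemma pairs_on_lines k L Y (S := [set l | `[< is_plane 1 l >] & l \subset L]) :
  is_plane k L -> #|Y :&: L| ^ 2 <= \sum_(l in S) #|Y :&: l| ^ 2 + #|Y :&: L|.
Proof.
move=> hL; set YL := Y :&: L.
have -> : \sum_(l in S) #|Y :&: l| ^ 2 =
    \sum_(x in YL) \sum_(y in YL) \sum_(l in S) ((x \in l) && (y \in l)).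
  transitivity (\sum_(l in S) (\sum_(x in YL) (x \in l)) ^ 2).
    apply: eq_bigr => l; rewrite inE => /andP [_ slL]; rewrite sum_mem_card.
    congr (#|pred_of_set _| ^ 2); apply/setP => x; rewrite !inE.
    by case: (boolP (x \in l)) => [/(subsetP slL) ->|]; rewrite ?andbT ?andbF.
  under eq_bigr do rewrite -mulnn big_distrlr /=.
  rewrite exchange_big; apply: eq_bigr => x _; rewrite exchange_big.
  by apply: eq_bigr => y _; apply: eq_bigr => l _; rewrite mulnb.
rewrite -[X in _ + X]sum1_card -big_split /= -mulnn -sum_nat_const.
apply: leq_sum => x xYL; rewrite -sum1_card (bigD1 x) //= addnC leq_add2r.
rewrite [leqRHS](bigD1 x) //=; apply: leq_trans (leq_addl _ _).
apply: leq_sum => y /andP [yYL yx].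
move: xYL yYL; rewrite !inE => /andP [_ xL] /andP [_ yL].
have yx' : y \notin [set x] by rewrite inE.
have [l [hl sxl yl minl]] := plane_join (plane_set1 x) yx'.
rewrite sub1set in sxl; rewrite (bigD1 l) /= ?sxl ?yl // inE.
by apply/andP; split; [exact/asboolP | apply: minl hL _ yL; rewrite sub1set].
Qed.

Lemma lines_through_leq k L p : is_plane k L -> p \in L ->
  #|[set l | [&& `[< is_plane 1 l >], l \subset L & p \in l]]| * q <= 2 * q ^ k.
Proof.
move=> hL pL; set S := [set l | _].
have h : #|S| * (q - 1) ^ 1 <= #|L| ^ 1.
  apply: (@count_planes_through _ _ 1 0 [set p]); first exact: plane_set1.
  move=> l; rewrite inE sub1set => /and3P [/asboolP hl slL pl]; split => // _.
  rewrite (setIidPr slL) (plane_card hl) expn0 expn1 subnKC //; exact: field_card_gt0.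
rewrite !expn1 (plane_card hL) in h.
have hq : q <= 2 * (q - 1).
  by rewrite mulnBr mul2n -addnn -addnBA ?leq_addr // field_card_gt1.
apply: leq_trans (leq_mul (leqnn _) hq) _; by rewrite mulnCA leq_mul2l h orbT.
Qed.

(** Lines meeting [Y] in few points cover at most about half of the pairs of
points of [Y] in [L], since each point is on about [q ^ k] lines of [L].  The other
pairs are on dense lines, each carrying at most [q ^ 2] pairs. *)
Lemma many_dense_lines k a L Y :
  is_plane k.+1 L -> q ^ k.+1 <= a * #|Y :&: L| -> 4 * a <= q ->
  (q ^ k.+1) ^ 2 <= 4 * a ^ 2 * q ^ 2 * #|subplanes_of (dense_lines (4 * a) Y) L|.
Proof.
move=> hL hY aq; set D := subplanes_of _ L; set m := #|Y :&: L| in hY.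
have hq : q <= q ^ k.+1 by rewrite expnS leq_pmulr // expn_gt0 field_card_gt0.
have a0 : 0 < a.
  rewrite lt0n; apply/eqP => a0; move: hY.
  by rewrite a0 mul0n leqNgt expn_gt0 field_card_gt0.
have m4 : 4 <= m by rewrite -(leq_pmul2l a0) mulnC (leq_trans aq) // (leq_trans hq).
have := pairs_on_lines Y hL; set S := [set l | _]; rewrite -/m.
rewrite (bigID (fun l => q <= 4 * a * #|Y :&: l|)) /=.
set dn := \sum_(l in S | q <= _) _; set pr := \sum_(l in S | ~~ _) _ => hm.
have hdn : dn <= #|D| * q ^ 2.
  rewrite -sum_nat_const; apply: (@leq_trans (\sum_(l in D) #|Y :&: l| ^ 2)).
    apply: eq_leq.
    by apply: eq_bigl => l; rewrite !inE andbAC.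
  apply: leq_sum => l; rewrite !inE => /andP [/andP [/asboolP hl _] _].
  by rewrite leq_exp2r // -[leqRHS]expn1 -(plane_card hl) subset_leq_card // subsetIr.
have hpr : 4 * a * pr <= 2 * a * m ^ 2.
  apply: (@leq_trans (\sum_(l in S) q * #|Y :&: l|)).
    rewrite /pr big_distrr /= big_mkcondr; apply: leq_sum => l _.
    case: ifP => //; rewrite -ltnNge => h.
    by rewrite -mulnn mulnA leq_mul2r ltnW ?orbT.
  have -> : \sum_(l in S) q * #|Y :&: l| = \sum_(p in Y :&: L) #|[set l in S | p \in l]| * q.
    rewrite -big_distrr /= mulnC -big_distrl /=; congr (_ * _).
    under [RHS]eq_bigr do rewrite -sum_mem_card.
    rewrite exchange_big; apply: eq_bigr => l; rewrite inE => /andP [_ slL].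
    rewrite sum_mem_card; apply: eq_card => x; rewrite !inE.
    by case: (boolP (x \in l)) => [/(subsetP slL) ->|]; rewrite ?andbT ?andbF.
  apply: (@leq_trans (\sum_(p in Y :&: L) 2 * q ^ k.+1)).
    apply: leq_sum => p; rewrite inE => /andP [_ pL].
    apply: leq_trans (lines_through_leq hL pL); rewrite leq_mul2r; apply/orP; right.
    by apply/subset_leq_card/subsetP => l; rewrite !inE andbA.
  rewrite sum_nat_const -/m; apply: (@leq_trans (m * (2 * (a * m)))).
    by rewrite !leq_mul2l hY !orbT.
  by apply: eq_leq; ring.
have hm2 : m ^ 2 <= 4 * (#|D| * q ^ 2).
  have : 2 * a * (2 * pr) <= 2 * a * m ^ 2 by rewrite (_ : 2 * a * (2 * pr) = 4 * a * pr) //; ring.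
  rewrite leq_pmul2l ?muln_gt0 ?a0 // => h.
  have : 4 * m <= m ^ 2 by rewrite -mulnn leq_mul2r m4 orbT.
  move: h hm hdn; clear; move: (m ^ 2) (#|D| * q ^ 2) => ? ?; lia.
apply: (@leq_trans ((a * m) ^ 2)); first by rewrite leq_exp2r.
rewrite expnMn; apply: leq_trans (leq_mul (leqnn _) hm2) _.
by apply: eq_leq; ring.
Qed.

End HeavyPoints.

(** Each plane contains about [q ^ (2 * k.+1)] dense lines, and with [k.+1] further
points of [Y] such a line spans the plane in about [q ^ (k.+2 * k.+1)] ways; so
[#|LL|] times these two quantities is at most a constant times
[#|D| * #|Y| ^ k.+1].  Unless [#|Y|] exceeds [q ^ (s + k.+3)], which is
sufficient by itself, this bounds [#|D|] from below, and [lines_union] bounds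
[#|Y|]. *)
Lemma heavy_points k s :
  exists C, forall (F : finFieldType) n (LL : {set {set 'rV[F]_n}}) Y,
    dense_planes k.+2 4 Y LL -> #|LL| <= #|F| ^ (k.+3 * s + k.+2) ->
    #|LL| * #|F| ^ s.+1 <= C * #|Y| * #|F| ^ (k.+3 * s).
Proof.
have [C1 hC1] := lines_union (s + k.+1) 16.
exists (16 ^ (k.+3 * s + k.+2 + s.+1) + 1 + C1 + 64 * 8 ^ k.+1 * C1) => F n LL Y hLL cLL.
set q := #|F| in cLL *; have q0 : 0 < q := field_card_gt0 F.
have [->|LL0] := posnP #|LL|; first by [].
have [q16|q16] := ltnP q 16.
  have Y0 : 0 < #|Y|.
    have /card_gt0P [L /hLL [_ h]] := LL0; rewrite lt0n; apply/eqP => /eqP.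
    rewrite cards_eq0 => /eqP X0; move: h; rewrite X0 set0I cards0 muln0.
    by rewrite leqNgt expn_gt0 q0.
  apply: leq_trans (leq_mul cLL (leqnn _)) _; rewrite -expnD.
  apply: leq_trans (_ : 16 ^ (k.+3 * s + k.+2 + s.+1) <= _).
    by rewrite leq_exp2r ?addnS // ltnW.
  rewrite -mulnA -[leqLHS]muln1; apply: leq_mul.
    by rewrite -!addnA leq_addr.
  by rewrite muln_gt0 Y0 expn_gt0 q0.
(* Then [#|Y|] beats the bound for the largest admissible [#|LL|]. *)
have big_case C' : q ^ (s + k.+3) <= C' * #|Y| ->
    #|LL| * q ^ s.+1 <= C' * #|Y| * q ^ (k.+3 * s).
  move=> h; apply: leq_trans (leq_mul cLL (leqnn _)) _; rewrite -expnD.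
  have -> : k.+3 * s + k.+2 + s.+1 = s + k.+3 + k.+3 * s by clear; lia.
  by rewrite expnD leq_mul2r h orbT.
have weak C' : C' <= 16 ^ (k.+3 * s + k.+2 + s.+1) + 1 + C1 + 64 * 8 ^ k.+1 * C1 ->
   #|LL| * q ^ s.+1 <= C' * #|Y| * q ^ (k.+3 * s) ->
   #|LL| * q ^ s.+1 <= (16 ^ (k.+3 * s + k.+2 + s.+1) + 1 + C1 + 64 * 8 ^ k.+1 * C1)
     * #|Y| * q ^ (k.+3 * s).
  by move=> hC h; apply: leq_trans h _; rewrite !leq_mul2r hC !orbT.
have [hY|hY] := leqP (q ^ (s + k.+3)) #|Y|.
  apply: (@weak 1); first by rewrite -!addnA addnCA leq_addr.
  by apply: big_case; rewrite mul1n.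
have := hC1 F n Y _ (@dense_linesP F n 16 Y); set D := dense_lines 16 Y; rewrite -/q.
have [hD|hD] := leqP #|D| (q ^ (2 * (s + k.+1) + 1)); last first.
  rewrite -expnD => h; apply: (@weak C1); first by rewrite -addnA addnCA leq_addr.
  apply: big_case; rewrite -(leq_pmul2r (_ : 0 < q ^ (2 * (s + k.+1)))) ?expn_gt0 ?q0 //.
  rewrite -expnD; apply: leq_trans h; rewrite leq_exp2l ?field_card_gt1 //.
  by clear; lia.
move=> hlines; apply: (@weak (64 * 8 ^ k.+1 * C1)); first exact: leq_addl.
(* [y4] is the ceiling of [q ^ k.+2 / 4], a lower bound for [#|Y :&: L|]. *)
pose y4 := (q ^ k.+2 + 3) %/ 4; pose z := y4 - q ^ k.+1.
have z8 : q ^ k.+2 <= 8 * z.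
  have : 8 * q ^ k.+1 <= q ^ k.+2 by rewrite (expnS q k.+1) leq_mul2r (leq_trans _ q16) ?orbT.
  rewrite /z /y4; move: (q ^ k.+2) (q ^ k.+1) => u v; clear; lia.
have zy L : L \in LL -> q ^ k.+1 + z <= #|Y :&: L|.
  move=> /hLL [_ h].
  have : 8 * q ^ k.+1 <= q ^ k.+2 by rewrite (expnS q k.+1) leq_mul2r (leq_trans _ q16) ?orbT.
  rewrite /z /y4; move: h; rewrite -/q; move: (q ^ k.+2) (q ^ k.+1) #|_| => u v w; clear; lia.
have count : \sum_(L in LL) #|subplanes_of D L| * z ^ k.+1 <= #|D| * #|Y| ^ k.+1.
  rewrite -big_distrl /= -sum_incidences big_distrl /= -sum_nat_const.
  apply: leq_sum => l lD; have [hl _] := dense_linesP lD.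
  apply: (count_planes_through hl) => L; rewrite inE => /andP [LLL slL].
  have [hL _] := hLL _ LLL; split => // _; exact: zy.
have count2 : #|LL| * ((q ^ k.+2) ^ 2 * (q ^ k.+2) ^ k.+1) <=
    64 * 8 ^ k.+1 * (#|D| * q ^ 2) * #|Y| ^ k.+1.
  rewrite -sum_nat_const.
  apply: (@leq_trans (\sum_(L in LL) 64 * q ^ 2 * #|subplanes_of D L| * (8 ^ k.+1 * z ^ k.+1))).
    apply: leq_sum => L /hLL [hL dL]; apply: leq_mul.
      exact: (many_dense_lines hL dL q16).
    by rewrite -expnMn leq_exp2r.
  have -> : \sum_(L in LL) 64 * q ^ 2 * #|subplanes_of D L| * (8 ^ k.+1 * z ^ k.+1) =
     64 * 8 ^ k.+1 * q ^ 2 * \sum_(L in LL) #|subplanes_of D L| * z ^ k.+1.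
    rewrite big_distrr; apply: eq_bigr => L _ /=; ring.
  apply: leq_trans (leq_mul (leqnn _) count) _.
  by apply: eq_leq; ring.
(* [X] is the exponent of [q] common to both sides after the two counts are combined. *)
pose X := k * k + 6 * k + 7.
rewrite -(leq_pmul2r (_ : 0 < q ^ X)) ?expn_gt0 ?q0 //.
have e1 : #|LL| * q ^ s.+1 * q ^ X =
   #|LL| * ((q ^ k.+2) ^ 2 * (q ^ k.+2) ^ k.+1) * q ^ (s + k.+1).+1.
  have e2 : (q ^ k.+2) ^ 2 * (q ^ k.+2) ^ k.+1 * q ^ (s + k.+1).+1 = q ^ (s.+1 + X).
    rewrite -(expnM q k.+2 2) -(expnM q k.+2 k.+1) -expnD -expnD.
    by congr (_ ^ _); rewrite /X; clear; lia.
  by rewrite -[LHS]mulnA -expnD -[RHS]mulnA e2.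
rewrite e1; apply: leq_trans (leq_mul count2 (leqnn _)) _.
have hY' : #|Y| ^ k.+1 <= q ^ ((s + k.+3) * k.+1).
  by rewrite expnM leq_exp2r // ltnW.
apply: (@leq_trans (64 * 8 ^ k.+1 * q ^ 2 * q ^ ((s + k.+3) * k.+1) *
    (C1 * #|Y| * q ^ (2 * (s + k.+1))))).
  have -> : 64 * 8 ^ k.+1 * (#|D| * q ^ 2) * #|Y| ^ k.+1 * q ^ (s + k.+1).+1 =
     64 * 8 ^ k.+1 * q ^ 2 * #|Y| ^ k.+1 * (#|D| * q ^ (s + k.+1).+1) by ring.
  apply: leq_mul => //; by rewrite leq_mul2l hY' orbT.
apply: eq_leq.
have -> : 64 * 8 ^ k.+1 * C1 * #|Y| * q ^ (k.+3 * s) * q ^ X =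
  64 * 8 ^ k.+1 * C1 * #|Y| * (q ^ (k.+3 * s + X)) by rewrite expnD; ring.
have -> : k.+3 * s + X = 2 + (s + k.+3) * k.+1 + 2 * (s + k.+1) by rewrite /X; clear; lia.
by rewrite !expnD; ring.
Qed.

(** * Shadows of families of planes *)

Local Open Scope nat_scope.

(** With at most [q ^ (k.+1 * (d - k) + k'.+1)] planes counted, this covers the range
of exponents up to [k'.+1] at once. *)
Definition shadow_bound d k k' := exists C, forall (F : finFieldType) n
    (LL : {set {set 'rV[F]_n}}), (forall L, L \in LL -> is_plane k L) ->
  minn #|LL| (#|F| ^ (k.+1 * (d - k) + k'.+1)) * #|F| ^ (k'.+1 * (d - k')) <=
  C * #|shadow k' LL| * #|F| ^ (k.+1 * (d - k)).

Lemma shadow_sub (F : finFieldType) n k (LL LL' : {set {set 'rV[F]_n}}) :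
  LL \subset LL' -> shadow k LL \subset shadow k LL'.
Proof.
move=> sLL; apply/subsetP => P /shadowP [L LLL h]; apply/shadowP; exists L => //.
exact: (subsetP sLL).
Qed.

Lemma shadow_shadow (F : finFieldType) n k k' (LL : {set {set 'rV[F]_n}}) :
  shadow k' (shadow k LL) \subset shadow k' LL.
Proof.
apply/subsetP => P /shadowP [Q /shadowP [L LLL [_ sQL]] [hP sPQ]].
by apply/shadowP; exists L => //; split => //; exact: subset_trans sPQ sQL.
Qed.

Lemma sum_points (F : finFieldType) n k (LL : {set {set 'rV[F]_n}}) :
  (forall L, L \in LL -> is_plane k L) ->
  \sum_(p : 'rV[F]_n) #|[set L in LL | p \in L]| = #|LL| * #|F| ^ k.
Proof.
move=> hLL; under eq_bigr do rewrite -sum_mem_card.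
rewrite exchange_big -sum_nat_const; apply: eq_bigr => L /hLL /plane_card <-.
by rewrite -sum1_card [RHS]big_mkcond; apply: eq_bigr => x _; case: (x \in L).
Qed.

Lemma shadow_bound_lines s : shadow_bound (s + 1) 1 0.
Proof.
have [C hC] := lines_union s 1; exists C => F n LL hLL.
rewrite addnK subn0 mul1n [s + 1]addn1.
pose X := \bigcup_(L in LL) L.
have sX L : L \in LL -> X :&: L = L.
  by move=> LLL; apply/setIidPr; exact: bigcup_sup.
have hX : dense_planes 1 1 X LL.
  by move=> L LLL; rewrite sX // (plane_card (hLL _ LLL)) mul1n; split => //; exact: hLL.
apply: leq_trans (hC F n X LL hX) _; rewrite leq_mul2r leq_mul2l; apply/orP; right.
apply/orP; right; rewrite -(card_imset X set1_inj); apply: subset_leq_card.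
apply/subsetP => P /imsetP [x /bigcupP [L LLL xL] ->].
by apply/shadowP; exists L => //; rewrite sub1set; split => //; exact: plane_set1.
Qed.

(** A point is heavy if it lies on more than [K] times the number of planes for which
the bound in its link is useful.  If light points carry half of the incidences,
summing the link bounds gives the claim; otherwise [heavy_points] makes the
set [Y] of heavy points larger than incidence counting allows, by the choice of
[K]. *)
Lemma shadow_bound_succ k s :
  shadow_bound (s + k.+1) k.+1 k -> shadow_bound (s + k.+2) k.+2 k.+1.
Proof.
move=> [C1]; rewrite addnK [s + k.+1]addnS subSn ?leq_addl // addnK => hC1.
have [C2 hC2] := heavy_points k s; pose K := 4 * C2 + 1.
exists (4 * K * C1) => F n LL' hLL'.
rewrite addnK [s + k.+2]addnS subSn ?leq_addl // addnK.
set q := #|F|; have q0 : 0 < q := field_card_gt0 F.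
have [LL sLL cLL] := exists_subset_card (geq_minl #|LL'| (q ^ (k.+3 * s + k.+2))).
rewrite -cLL; have hLL L : L \in LL -> is_plane k.+2 L by move/(subsetP sLL)/hLL'.
have cN : #|LL| <= q ^ (k.+3 * s + k.+2) by rewrite cLL geq_minr.
apply: leq_trans (_ : 4 * K * C1 * #|shadow k.+1 LL| * q ^ (k.+3 * s) <= _); last first.
  by rewrite leq_mul2r leq_mul2l subset_leq_card ?orbT // shadow_sub.
pose N p := #|[set L in LL | p \in L]|.
pose XX p := #|[set P in shadow k.+1 LL | p \in P]|.
pose Y := [set p | K * q ^ (k.+2 * s + k.+1) < N p].
have sumN : \sum_p N p = #|LL| * q ^ k.+2 := sum_points hLL.
have sumX : \sum_p XX p = #|shadow k.+1 LL| * q ^ k.+1.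
  by apply: sum_points => P /shadowP [? _ []].
have light p : p \notin Y ->
    N p * q ^ (k.+1 * s.+1) <= 2 * K * C1 * XX p * q ^ (k.+2 * s).
  rewrite inE -leqNgt => hp.
  have [M [hM cM sM]] : exists M : {set {set 'rV[F]_n}}, [/\ forall L, L \in M -> is_plane k.+1 L,
      N p <= 2 * #|M| & #|shadow k M| <= XX p].
    have [|M [hM cM sM]] := @link_at_point _ _ p k.+1 k [set L in LL | p \in L].
      by move=> L; rewrite inE => /andP [/hLL].
    exists M; split => //; apply: leq_trans sM _; apply: subset_leq_card.
    apply/subsetP => P; rewrite !inE => /andP [hP ->]; rewrite andbT.
    apply: (subsetP (shadow_sub _ _)) hP; apply/subsetP => L.
    by rewrite inE => /andP [].
  have hmin : N p <= 2 * K * minn #|M| (q ^ (k.+2 * s + k.+1)).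
    rewrite minnMr leq_min; apply/andP; split.
      by apply: leq_trans cM _; rewrite leq_mul2r leq_pmulr ?orbT // /K addn1.
    by apply: leq_trans hp _; rewrite leq_mul2r leq_pmull ?orbT.
  apply: leq_trans (leq_mul hmin (leqnn _)) _; rewrite -mulnA.
  apply: leq_trans (leq_mul (leqnn _) (hC1 F n M hM)) _.
  by rewrite mulnA -/q leq_mul2r mulnA leq_mul2l sM !orbT.
have [caseA|caseB] := leqP (#|LL| * q ^ k.+2) (2 * \sum_(p in ~: Y) N p).
  have h : #|LL| * q ^ k.+2 * q ^ (k.+1 * s.+1) <=
      4 * K * C1 * (#|shadow k.+1 LL| * q ^ k.+1) * q ^ (k.+2 * s).
    apply: leq_trans (leq_mul caseA (leqnn _)) _; rewrite -mulnA big_distrl /= -sumX.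
    apply: (@leq_trans (2 * \sum_(p in ~: Y) 2 * K * C1 * XX p * q ^ (k.+2 * s))).
      by rewrite leq_mul2l; apply: leq_sum => p; rewrite inE; exact: light.
    rewrite -big_distrl -big_distrr /=.
    rewrite (_ : 2 * (2 * K * C1 * _ * _) =
      4 * K * C1 * (\sum_(p in ~: Y) XX p) * q ^ (k.+2 * s)); last by ring.
    rewrite leq_mul2r leq_mul2l; apply/orP; right; apply/orP; right.
    by rewrite [leqLHS]big_mkcond; apply: leq_sum => p _; case: ifP.
  rewrite -(leq_pmul2r (_ : 0 < q ^ k.+1)) ?expn_gt0 ?q0 //.
  have := leq_mul h (leqnn (q ^ s)).
  rewrite (_ : #|LL| * q ^ k.+2 * q ^ (k.+1 * s.+1) * q ^ s = #|LL| * q ^ (k.+2 * s.+1) * q ^ k.+1).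
    move/leq_trans; apply; apply: eq_leq.
    by rewrite (_ : k.+3 * s = k.+2 * s + s) ?expnD; [ring | clear; lia].
  have e : q ^ k.+2 * q ^ (k.+1 * s.+1) * q ^ s = q ^ (k.+2 * s.+1) * q ^ k.+1.
    by rewrite -expnD -expnD -expnD; congr (_ ^ _); clear; lia.
  by rewrite -(mulnA #|LL| (q ^ k.+2)) -(mulnA #|LL|) e mulnA.
have [LL0|LL0] := posnP #|LL|; first by rewrite LL0.
exfalso.
(* The remaining planes carry less than a quarter of all incidences, so more than a
   quarter of the planes are in [L4]. *)
pose L4 := [set L in LL | q ^ k.+2 <= 4 * #|Y :&: L|].
have hL4 : dense_planes k.+2 4 Y L4 by move=> L; rewrite inE => /andP [/hLL].
have sumY : \sum_(p in Y) N p = \sum_(L in LL) #|Y :&: L|.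
  rewrite /N; under eq_bigr do rewrite -sum_mem_card.
  rewrite exchange_big; apply: eq_bigr => L _; rewrite sum_mem_card.
  by apply: eq_card => x; rewrite !inE.
have splitN : \sum_(p in Y) N p + \sum_(p in ~: Y) N p = #|LL| * q ^ k.+2.
  rewrite -sumN [RHS](bigID (mem Y)) /=; congr (_ + _).
  by apply: eq_bigl => p; rewrite inE.
have upper : 4 * \sum_(p in Y) N p <= 4 * #|L4| * q ^ k.+2 + #|LL| * q ^ k.+2.
  rewrite sumY big_distrr /=.
  have -> : 4 * #|L4| * q ^ k.+2 =
      \sum_(L in LL) 4 * (q ^ k.+2 <= 4 * #|Y :&: L|) * q ^ k.+2.
    by rewrite -big_distrl -big_distrr /= sum_mem_card.
  rewrite -sum_nat_const -big_split /=; apply: leq_sum => L /hLL hL.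
  case: (leqP (q ^ k.+2) (4 * #|Y :&: L|)) => h; last by rewrite muln0 mul0n add0n ltnW.
  apply: leq_trans (leq_addr _ _); rewrite muln1 leq_mul2l /=.
  by rewrite -(plane_card hL) subset_leq_card // subsetIr.
have L4N : #|LL| < 4 * #|L4|.
  rewrite -(ltn_pmul2r (_ : 0 < q ^ k.+2)) ?expn_gt0 ?q0 //.
  move: caseB splitN upper; clear.
  move: (\sum_(p in Y) _) (\sum_(p in ~: Y) _) (#|LL| * _) (4 * #|L4| * _) => a b c e; lia.
have cL4 : #|L4| <= q ^ (k.+3 * s + k.+2).
  apply: leq_trans cN; apply/subset_leq_card/subsetP => L.
  by rewrite inE => /andP [].
have heavy := hC2 F n L4 Y hL4 cL4.
have KY : K * q ^ (k.+2 * s + k.+1) * #|Y| <= 4 * #|L4| * q ^ k.+2.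
  apply: (@leq_trans (#|LL| * q ^ k.+2)); last by rewrite leq_mul2r ltnW ?orbT.
  rewrite -splitN; apply: leq_trans (leq_addr _ _).
  rewrite mulnC -sum_nat_const; apply: leq_sum => p; rewrite inE; exact: ltnW.
have pos : 0 < #|L4| * q ^ (k.+3 * s + k.+2).
  by rewrite muln_gt0 expn_gt0 q0 andbT; move: L4N; case: #|L4|; rewrite ?muln0.
have : K * (#|L4| * q ^ (k.+3 * s + k.+2)) <= C2 * 4 * (#|L4| * q ^ (k.+3 * s + k.+2)).
  apply: (@leq_trans (K * q ^ (k.+2 * s + k.+1) * (C2 * #|Y| * q ^ (k.+3 * s)))).
    apply: leq_trans (leq_mul (leqnn (K * q ^ (k.+2 * s + k.+1))) heavy).
    apply: eq_leq.
    rewrite (_ : k.+3 * s + k.+2 = (k.+2 * s + k.+1) + s.+1); last by clear; lia.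
    by rewrite expnD; ring.
  have := leq_mul KY (leqnn (C2 * q ^ (k.+3 * s))).
  rewrite (_ : K * q ^ (k.+2 * s + k.+1) * (C2 * #|Y| * q ^ (k.+3 * s)) =
    K * q ^ (k.+2 * s + k.+1) * #|Y| * (C2 * q ^ (k.+3 * s))); last by ring.
  move/leq_trans; apply; apply: eq_leq.
  by rewrite expnD; ring.
by rewrite leq_pmul2r // /K mulnC addn1 ltnn.
Qed.

Lemma shadow_bound_pred k s : shadow_bound (s + k.+1) k.+1 k.
Proof.
elim: k => [|k IH]; [exact: shadow_bound_lines | exact: shadow_bound_succ].
Qed.

(** The shadow in dimension [k] of planes of dimension [k.+1] may exceed the number
of planes that the next bound counts; in that case the latter bound is already
at its maximum. *)
Lemma shadow_bound_all d k k' : k' < k -> k <= d -> shadow_bound d k k'.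
Proof.
elim: k => // k IH; rewrite ltnS leq_eqVlt => /predU1P [->|k'k] kd.
  by rewrite -(subnK kd); exact: shadow_bound_pred.
have [C1 hC1] : shadow_bound d k.+1 k by rewrite -(subnK kd); exact: shadow_bound_pred.
have [C2 hC2] := IH k'k (ltnW kd).
exists (C1 * C2 + C2) => F n LL hLL.
have h1 := hC1 F n LL hLL.
have hsh L : L \in shadow k LL -> is_plane k L by move=> /shadowP [? _ []].
have := hC2 F n _ hsh; have := subset_leq_card (shadow_shadow k k' LL).
move: h1; set q := #|F|; have q0 : 0 < q := field_card_gt0 F.
set a := k.+2 * _; set b := k.+1 * _; set e := k'.+1 * _.
set SH := #|shadow k LL|; set S2 := #|shadow k' (shadow k LL)|; set S := #|shadow k' LL|%N.
move=> h1 sS h2; set N := minn _ _.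
have h3 : N * q ^ b <= C1 * SH * q ^ a.
  apply: leq_trans h1; rewrite leq_mul2r; apply/orP; right; rewrite leq_min geq_minl /=.
  by apply: leq_trans (geq_minr _ _) _; rewrite leq_exp2l ?field_card_gt1 // leq_add2l ltnW.
have pb : 0 < q ^ b by rewrite expn_gt0 q0.
have final C' : C' <= C1 * C2 + C2 -> N * q ^ e <= C' * S2 * q ^ a ->
    N * q ^ e <= (C1 * C2 + C2) * S * q ^ a.
  by move=> hC h; apply: leq_trans h _; rewrite leq_mul2r leq_mul ?orbT.
have [hS|hS] := leqP SH (q ^ (b + k'.+1)).
  rewrite (minn_idPl hS) in h2.
  apply: (final (C1 * C2)); first exact: leq_addr.
  rewrite -(leq_pmul2r pb) mulnAC; apply: leq_trans (leq_mul h3 (leqnn (q ^ e))) _.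
  rewrite (_ : C1 * SH * q ^ a * q ^ e = C1 * q ^ a * (SH * q ^ e)); last by ring.
  apply: leq_trans (leq_mul (leqnn _) h2) _.
  by apply: eq_leq; ring.
rewrite (minn_idPr (ltnW hS)) in h2.
apply: (final C2); first exact: leq_addl.
have h4 : q ^ k'.+1 * q ^ e <= C2 * S2.
  by rewrite -(leq_pmul2r pb); apply: leq_trans h2; rewrite expnD -[leqRHS]mulnA [leqRHS]mulnC.
apply: leq_trans (leq_mul (geq_minr _ _) (leqnn _)) _.
by rewrite expnD -mulnA mulnC leq_mul2r h4 orbT.
Qed.

Local Close Scope nat_scope.
Local Open Scope ring_scope.

Theorem theorem1p7 (R : realType) (d k k' : nat)
    (hkd : (k <= d)%N) (hk'k : (k' < k)%N) :
  exists2 c : R, 0 < c &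
    forall (F : finFieldType) (n : nat) (beta : R) (LL : {set {set 'rV[F]_n}}),
      (0 < n)%N ->
      0 <= beta <= k'.+1%:R ->
      (forall L, L \in LL -> is_plane k L) ->
      #|F|%:R `^ ((k.+1 * (d - k))%:R + beta) <= #|LL|%:R :> R ->
      c * #|F|%:R `^ ((k'.+1 * (d - k'))%:R + beta)
        <= #|\bigcup_(L in LL) planes_in k' L|%:R.
Proof.
have [C hC] := shadow_bound_all hk'k hkd.
have C0 : 0 < C.+1%:R :> R by rewrite ltr0n.
exists C.+1%:R^-1; first by rewrite invr_gt0.
move=> F n beta LL _ /andP [b0 b1] hLL hcard.
have := hC F n LL hLL; rewrite -/(shadow k' LL).
set a := (k.+1 * _)%N in hcard *; set e := (k'.+1 * _)%N; set S := #|shadow k' LL|%N.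
have q1 : 1 <= #|F|%:R :> R by rewrite ler1n field_card_gt0.
have q0 : 0 < #|F|%:R :> R by rewrite ltr0n field_card_gt0.
have qD (m : nat) : #|F|%:R `^ (m%:R + beta) = #|F|%:R ^+ m * #|F|%:R `^ beta :> R.
  by rewrite powRD ?powR_mulrn ?ltW // (gt_eqF q0) implybT.
rewrite qD in hcard *.
rewrite qD => h.
have hmin : #|F|%:R ^+ a * #|F|%:R `^ beta <= (minn #|LL| (#|F| ^ (a + k'.+1)))%N%:R :> R.
  rewrite natr_min le_min hcard natrX exprD; apply: ler_wpM2l; first exact/exprn_ge0/ltW.
  by rewrite -powR_mulrn; [exact: ler_powR | exact: ltW].
have pa : 0 < #|F|%:R ^+ a :> R by rewrite exprn_gt0.
rewrite mulrC ler_pdivrMr // -(ler_pM2l pa) mulrCA mulrC.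
have h2 : (minn #|LL| (#|F| ^ (a + k'.+1)))%N%:R * #|F|%:R ^+ e <=
    C.+1%:R * S%:R * #|F|%:R ^+ a :> R.
  rewrite -!natrX -!natrM ler_nat; apply: leq_trans h _.
  by rewrite leq_mul2r leq_mul2r leqnSn !orbT.
apply: le_trans (le_trans _ h2) _.
  by apply: ler_wpM2r hmin; rewrite exprn_ge0 // ltW.
by rewrite mulrC [_ * S%:R]mulrC.
Qed.
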